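(* Let $\mathcal{G}$ be a totally disconnected étale groupoid, let $\mathcal{G}'\subset\mathcal{G}$ be an open subgroupoid with $\mathcal{G}'^{(0)}=\mathcal{G}^{(0)}$, put $\Delta:=\mathcal{G}\setminus\mathcal{G}'$, $\mathcal{H}:=\mathcal{G}|r(\Delta)$ and $\mathcal{H}':=\mathcal{G}'|r(\Delta)$, where $\mathcal{H}$ and $\mathcal{H}'$ carry the topologies described in the context. Suppose that the inclusion $\mathcal{G}'\subset\mathcal{G}$ is regular. Let $A$ be a discrete abelian group. Then there are short exact sequences of chain complexes $$0\to\mathcal{C}(\mathcal{G}',A)\to\mathcal{C}(\mathcal{G},A)\to\mathcal{C}(\mathcal{G},A)/\mathcal{C}(\mathcal{G}',A)\to0,$$ $$0\to\mathcal{C}(\mathcal{H}',A)\to\mathcal{C}(\mathcal{H},A)\to\mathcal{C}(\mathcal{H},A)/\mathcal{C}(\mathcal{H}',A)\to0,$$ and the two quotient complexes are identified: $\mathcal{C}(\mathcal{G},A)/\mathcal{C}(\mathcal{G}',A)=\mathcal{C}(\mathcal{H},A)/\mathcal{C}(\mathcal{H}',A)$. That is, there is an isomorphism of chain complexes between them which in degree $n$ matches the class of $f\in C_c(\mathcal{G}^{(n)},A)$ with the class of $h\in C_c(\mathcal{H}^{(n)},A)$ exactly when $f$ and $h$ agree on the set $\mathcal{G}^{(n)}\setminus\mathcal{G}'^{(n)}=\mathcal{H}^{(n)}\setminus\mathcal{H}'^{(n)}$.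
   Context: An étale groupoid means a second countable locally compact Hausdorff topological groupoid whose range map is a local homeomorphism. $\mathcal{G}^{(0)}$ is the unit space, $s(g)=g^{-1}g$, $r(g)=gg^{-1}$. For $Y\subset\mathcal{G}^{(0)}$, $\mathcal{G}|Y:=r^{-1}(Y)\cap s^{-1}(Y)$. A space is totally disconnected if its connected components are singletons. For $n\ge1$, $\mathcal{G}^{(n)}$ is the space of $(g_1,\dots,g_n)\in\mathcal{G}^n$ with $s(g_i)=r(g_{i+1})$ for $1\le i\le n-1$ (relative topology from the product). Chain complexes. $C_c(X,A)$ is the abelian group of continuous compactly supported functions $X\to A$. For a local homeomorphism $\pi:X\to Y$, $\pi_*:C_c(X,A)\to C_c(Y,A)$ is $\pi_*(f)(y)=\sum_{\pi(x)=y}f(x)$. For $n\geq2$ and $0\le i\le n$ let $d_i:\mathcal{G}^{(n)}\to\mathcal{G}^{(n-1)}$ be $d_0(g_1,\dots,g_n)=(g_2,\dots,g_n)$, $d_i(g_1,\dots,g_n)=(g_1,\dots,g_ig_{i+1},\dots,g_n)$ for $1\le i\le n-1$, $d_n(g_1,\dots,g_n)=(g_1,\dots,g_{n-1})$; for $n=1$, $d_0=s$, $d_1=r$. Put $\partial_n=\sum_{i=0}^n(-1)^id_{i*}$ and $\mathcal{C}(\mathcal{G},A)=(C_c(\mathcal{G}^{(n)},A),\partial_n)_{n\ge0}$. If $\mathcal{G}'\subset\mathcal{G}$ is an open subgroupoid, $\mathcal{C}(\mathcal{G}',A)\to\mathcal{C}(\mathcal{G},A)$ is the inclusion given by extension by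 zero; likewise for $\mathcal{H}'\subset\mathcal{H}$. Regularity. The inclusion $\mathcal{G}'\subset\mathcal{G}$ is regular if $r:\Delta\to r(\Delta)$ is open when $r(\Delta)$ carries the quotient topology from this map ($\Delta$ has the relative topology from $\mathcal{G}$); equivalently, for every open $U\subset\Delta$ the set $r^{-1}(r(U))\cap\Delta$ is open in $\Delta$. Topologies on $\mathcal{H},\mathcal{H}'$. $\mathcal{H}'$ is a subgroupoid of $\mathcal{H}$, $\mathcal{H}=\mathcal{H}'\sqcup\Delta$, $\mathcal{H}^{(0)}=\mathcal{H}'^{(0)}=r(\Delta)$. Let $m:\mathcal{G}^{(2)}\to\mathcal{G}$ be multiplication. The map $m:(\Delta\times\Delta)\cap m^{-1}(\mathcal{G}')\to\mathcal{H}'$ (defined on composable pairs in $\Delta\times\Delta$ with product in $\mathcal{G}'$) is surjective; $\mathcal{H}'$ is given the quotient topology from it, and $\mathcal{H}=\mathcal{H}'\sqcup\Delta$ the disjoint union topology, $\Delta$ having the relative topology from $\mathcal{G}$. When the inclusion $\mathcal{G}'\subset\mathcal{G}$ is regular, $\mathcal{H}$ and $\mathcal{H}'$ are étale groupoids and $\mathcal{H}'$ is clopen in $\mathcal{H}$. *)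

(* Defs.v *)
From HB Require Import structures.
From mathcomp Require Import all_boot all_order all_algebra.
From mathcomp Require Import all_classical.
From mathcomp Require Import topology_structure discrete_topology product_topology.
From mathcomp Require Import function_spaces subspace_topology subtype_topology.
From mathcomp Require Import compact connected separation_axioms.

Set Implicit Arguments.
Unset Strict Implicit.
Unset Printing Implicit Defensive.
Import GRing.Theory.
Local Open Scope classical_set_scope.
Local Open Scope ring_scope.

(* Multiplication is a total function; its value at (g, h) is meaningful only
   when g^-1 g = h h^-1, i.e. when (g, h) is composable. *)
HB.mixin Record isGroupoid (G : Type) := {
  ginv : G -> G;
  gmul : G -> G -> G;
  ginvK : involutive ginv;
  gmulA : forall g h k,
    gmul (ginv g) g = gmul h (ginv h) -> gmul (ginv h) h = gmul k (ginv k) ->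
    gmul (gmul g h) k = gmul g (gmul h k);
  gmul_src : forall g h, gmul (ginv g) g = gmul h (ginv h) ->
    gmul (ginv (gmul g h)) (gmul g h) = gmul (ginv h) h;
  gmul_rng : forall g h, gmul (ginv g) g = gmul h (ginv h) ->
    gmul (gmul g h) (ginv (gmul g h)) = gmul g (ginv g);
  gmulKV : forall g h, gmul (ginv g) g = gmul h (ginv h) ->
    gmul (ginv g) (gmul g h) = h;
  gmulVK : forall g h, gmul (ginv g) g = gmul h (ginv h) ->
    gmul (gmul g h) (ginv h) = g
}.

#[short(type="groupoidType")]
HB.structure Definition Groupoid := {G of isGroupoid G}.

(* A topological space with a groupoid structure; compatibility of the two is
   the predicate [topological_groupoid] below. *)
#[short(type="groupoidSpaceType")]
HB.structure Definition GroupoidSpace := {G of isGroupoid G & Topological G}.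

Section GroupoidTheory.
Context {G : groupoidType}.
Implicit Types g h k : G.

Definition gsrc g : G := gmul (ginv g) g.
Definition grng g : G := gmul g (ginv g).
Definition gcomp g h : Prop := gsrc g = grng h.
Definition gunits : set G := range gsrc.

Lemma gsrcM g h : gcomp g h -> gsrc (gmul g h) = gsrc h.
Proof. exact: gmul_src. Qed.

Lemma grngM g h : gcomp g h -> grng (gmul g h) = grng g.
Proof. exact: gmul_rng. Qed.

Lemma gsrcV g : gsrc (ginv g) = grng g.
Proof. by rewrite /gsrc ginvK. Qed.

Lemma grngV g : grng (ginv g) = gsrc g.
Proof. by rewrite /grng ginvK. Qed.

Lemma gsrc_unit g : gunits (gsrc g).
Proof. by exists g. Qed.

Lemma grng_unit g : gunits (grng g).
Proof. by exists (ginv g) => //; rewrite gsrcV. Qed.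

Lemma gcompVg g : gcomp (ginv g) g.
Proof. exact: gsrcV. Qed.

Lemma gcompgV g : gcomp g (ginv g).
Proof. by rewrite /gcomp grngV. Qed.

Lemma gsrc_src g : gsrc (gsrc g) = gsrc g.
Proof. exact: gsrcM (gcompVg g). Qed.

Lemma gsrc_rng g : gsrc (grng g) = grng g.
Proof. by rewrite (gsrcM (gcompgV g)) gsrcV. Qed.

Lemma grng_src g : grng (gsrc g) = gsrc g.
Proof. by rewrite (grngM (gcompVg g)) grngV. Qed.

Lemma grng_rng g : grng (grng g) = grng g.
Proof. exact: grngM (gcompgV g). Qed.

End GroupoidTheory.

Record groupoid_hom (K L : groupoidType) := GroupoidHom {
  ghom :> K -> L;
  ghomV : forall g, ghom (ginv g) = ginv (ghom g);
  ghomM : forall g h, gcomp g h -> ghom (gmul g h) = gmul (ghom g) (ghom h)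
}.

Lemma ghom_src (K L : groupoidType) (p : groupoid_hom K L) g :
  p (gsrc g) = gsrc (p g).
Proof. by rewrite /gsrc ghomM ?ghomV//; exact: gcompVg. Qed.

Lemma ghom_rng (K L : groupoidType) (p : groupoid_hom K L) g :
  p (grng g) = grng (p g).
Proof. by rewrite /grng ghomM ?ghomV//; exact: gcompgV. Qed.

Record subgroupoid (G : groupoidType) := Subgroupoid {
  sg_set :> set G;
  sg_inv : forall g, sg_set g -> sg_set (ginv g);
  sg_mul : forall g h, gcomp g h -> sg_set g -> sg_set h -> sg_set (gmul g h)
}.

Section SubgroupoidStructure.
Context {G : groupoidType} (K : subgroupoid G).

Definition sgV (x : K) : K := SigSub (mem_set (sg_inv (set_valP x))).
Definition sgM (x y : K) : K := insubd x (gmul (val x) (val y)).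

Lemma val_sgM (x y : K) : gcomp (val x) (val y) ->
  val (sgM x y) = gmul (val x) (val y).
Proof.
move=> xy; rewrite val_insubd mem_set//.
by apply: sg_mul => //; exact: set_valP.
Qed.

Lemma val_sgsrc (x : K) : val (sgM (sgV x) x) = gsrc (val x).
Proof. by rewrite val_sgM//=; exact: gcompVg. Qed.

Lemma val_sgrng (x : K) : val (sgM x (sgV x)) = grng (val x).
Proof. by rewrite val_sgM//=; exact: gcompgV. Qed.

Lemma sg_gcomp (x y : K) : sgM (sgV x) x = sgM y (sgV y) ->
  gcomp (val x) (val y).
Proof. by move=> /(congr1 val); rewrite val_sgsrc val_sgrng. Qed.

Fact sgVK : involutive sgV.
Proof. by move=> x; apply: val_inj; rewrite /= ginvK. Qed.

Fact sgMA x y z : sgM (sgV x) x = sgM y (sgV y) ->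
  sgM (sgV y) y = sgM z (sgV z) -> sgM (sgM x y) z = sgM x (sgM y z).
Proof.
move=> /sg_gcomp xy /sg_gcomp yz; apply: val_inj.
rewrite val_sgM; last by rewrite val_sgM// /gcomp gsrcM.
rewrite [RHS]val_sgM; last by rewrite val_sgM// /gcomp grngM.
by rewrite !val_sgM//; exact: gmulA.
Qed.

Fact sgM_src x y : sgM (sgV x) x = sgM y (sgV y) ->
  sgM (sgV (sgM x y)) (sgM x y) = sgM (sgV y) y.
Proof.
by move=> /sg_gcomp xy; apply: val_inj; rewrite !val_sgsrc val_sgM// gsrcM.
Qed.

Fact sgM_rng x y : sgM (sgV x) x = sgM y (sgV y) ->
  sgM (sgM x y) (sgV (sgM x y)) = sgM x (sgV x).
Proof.
by move=> /sg_gcomp xy; apply: val_inj; rewrite !val_sgrng val_sgM// grngM.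
Qed.

Fact sgMKV x y : sgM (sgV x) x = sgM y (sgV y) -> sgM (sgV x) (sgM x y) = y.
Proof.
move=> /sg_gcomp xy; apply: val_inj; rewrite val_sgM.
  by rewrite val_sgM//; exact: gmulKV.
by rewrite val_sgM//= /gcomp gsrcV grngM.
Qed.

Fact sgMVK x y : sgM (sgV x) x = sgM y (sgV y) -> sgM (sgM x y) (sgV y) = x.
Proof.
move=> /sg_gcomp xy; apply: val_inj; rewrite val_sgM.
  by rewrite val_sgM//; exact: gmulVK.
by rewrite val_sgM//= /gcomp grngV gsrcM.
Qed.

HB.instance Definition _ := isGroupoid.Build (set_type K)
  sgVK sgMA sgM_src sgM_rng sgMKV sgMVK.

Fact sg_val_hom : forall x y : K, gcomp x y ->
  val (gmul x y) = gmul (val x) (val y).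
Proof. by move=> x y /sg_gcomp xy; exact: val_sgM. Qed.

Definition sg_incl : groupoid_hom (set_type K) G :=
  @GroupoidHom (set_type K) G val (fun=> erefl) sg_val_hom.

End SubgroupoidStructure.

Section SubgroupoidSpace.
Context {G : groupoidSpaceType} (K : subgroupoid G).

Definition sg_space : Type := set_type K.

HB.instance Definition _ := Topological.copy sg_space (set_type K).
HB.instance Definition _ := Groupoid.copy sg_space (set_type K).

Definition sg_space_incl : groupoid_hom sg_space G := sg_incl K.

End SubgroupoidSpace.

Fact fullg_inv (G : groupoidType) (g : G) : setT g -> setT (ginv g).
Proof. by []. Qed.
Fact fullg_mul (G : groupoidType) (g h : G) :
  gcomp g h -> setT g -> setT h -> setT (gmul g h).
Proof. by []. Qed.
Definition fullg (G : groupoidType) : subgroupoid G :=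
  Subgroupoid (@fullg_inv G) (@fullg_mul G).

(* K|Y = K `&` r^-1(Y) `&` s^-1(Y) *)
Section Reduction.
Context {G : groupoidType} (K : subgroupoid G) (Y : set G).

Definition reduction_set : set G := [set g | [/\ sg_set K g, Y (grng g) & Y (gsrc g)]].

Fact reduction_inv g : reduction_set g -> reduction_set (ginv g).
Proof. by move=> [Kg Yr Ys]; split; rewrite ?grngV ?gsrcV//; exact: sg_inv. Qed.

Fact reduction_mul g h : gcomp g h ->
  reduction_set g -> reduction_set h -> reduction_set (gmul g h).
Proof.
move=> gh [Kg Yrg _] [Kh _ Ysh]; split; [exact: sg_mul| |].
  by rewrite grngM.
by rewrite gsrcM.
Qed.

Definition reduction : subgroupoid G := Subgroupoid reduction_inv reduction_mul.

End Reduction.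

Definition local_homeomorphism (X Y : topologicalType) (f : X -> Y) : Prop :=
  forall x : X, exists U : set X, exists g : Y -> X,
    [/\ open_nbhs x U, open (f @` U), {in U, cancel f g},
        {within U, continuous f} & {within f @` U, continuous g}].

Definition topological_groupoid (G : groupoidSpaceType) : Prop :=
  continuous (ginv : G -> G) /\
  {within [set p : G * G | gcomp p.1 p.2],
    continuous (fun p : G * G => gmul p.1 p.2)}.

Definition range_map (G : groupoidSpaceType) (g : G) : (gunits : set G) :=
  SigSub (mem_set (grng_unit g)).
Definition source_map (G : groupoidSpaceType) (g : G) : (gunits : set G) :=
  SigSub (mem_set (gsrc_unit g)).

Definition etale_groupoid (G : groupoidSpaceType) : Prop :=
  [/\ @second_countable G, locally_compact [set: G], hausdorff_space G,
      topological_groupoid G & local_homeomorphism (@range_map G)].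

Section Nerve.
Context (G : groupoidSpaceType).

Definition composable n : set {ptws 'I_n -> G} :=
  [set g | forall i j : 'I_n, j = i.+1 :> nat -> gcomp (g i) (g j)].

(* G^(n); G^(0) is the unit space rather than the one-point space of empty
   tuples. *)
Definition nerve (n : nat) : topologicalType :=
  if n is _.+1 then set_type (@composable n) else set_type (gunits : set G).

(* The map d_i on n.+2 composable elements (g_1, ..., g_(n+2)). With 0-based
   positions k <= n, the entry of d_i g at k is g_(k+1) if k+1 < i,
   g_(k+1) g_(k+2) if k+1 = i, and g_(k+2) if k+1 > i; this covers the extreme
   cases i = 0 and i = n+2 as well. *)
Definition face_fun n (i : 'I_n.+3) (g : 'I_n.+2 -> G) (k : 'I_n.+1) : G :=
  if (k.+1 < i)%N then g (inord k)
  else if k.+1 == i then gmul (g (inord k)) (g (inord k.+1))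
  else g (inord k.+1).

Lemma face_composable n (i : 'I_n.+3) (g : 'I_n.+2 -> G) :
  composable g -> composable (face_fun i g).
Proof.
move=> cg j k kj.
have kn := ltn_ord k; rewrite kj in kn.
have c m : (m < n.+1)%N -> gcomp (g (inord m)) (g (inord m.+1)).
  move=> mn; apply: cg; rewrite !inordK//; exact: ltnW.
have cj := c _ (ltnW kn); have ck := c _ kn; rewrite /face_fun kj.
case: (ltngtP j.+1 i) => ji.
- case: (ltngtP j.+2 i) => ji2 //.
    by move: ji2; rewrite ltnNge ji.
  by rewrite /gcomp grngM.
- by rewrite ltnNge (leq_trans (ltnW ji)) ?leqnSn//= gtn_eqF// (ltn_trans ji).
- by rewrite -ji ltnNge leqnSn/= gtn_eqF// /gcomp gsrcM.
Qed.

Definition face (n : nat) : 'I_n.+2 -> nerve n.+1 -> nerve n :=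
  match n return 'I_n.+2 -> nerve n.+1 -> nerve n with
  | 0 => fun i x => if i == ord0 then source_map (val x ord0)
                    else range_map (val x ord0)
  | m.+1 => fun i x => SigSub (mem_set (face_composable i (set_valP x)))
  end.

End Nerve.

Section NerveMap.
Context (K L : groupoidSpaceType) (p : groupoid_hom K L).

Lemma ghom_unit (u : K) : gunits u -> gunits (p u).
Proof. by move=> [g _ <-]; exists (p g) => //; rewrite ghom_src. Qed.

Lemma ghom_composable n (g : 'I_n -> K) :
  composable g -> composable (fun i => p (g i)).
Proof.
by move=> cg i j ij; rewrite /gcomp -ghom_src -ghom_rng (cg _ _ ij).
Qed.

Definition nerve_map (n : nat) : nerve K n -> nerve L n :=
  match n return nerve K n -> nerve L n with
  | 0 => fun x => SigSub (mem_set (ghom_unit (set_valP x)))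
  | m.+1 => fun x => SigSub (mem_set (ghom_composable (set_valP x)))
  end.

(* K^(n) is viewed as a subset of L^(n) when p is an inclusion. *)
Definition nerve_compl (n : nat) : set (nerve L n) := ~` range (@nerve_map n).

End NerveMap.

Arguments nerve_map {K L} p n.
Arguments nerve_compl {K L} p n.

Section CompactSupport.
Context (X : topologicalType) (A : zmodType).

Definition fsupp (f : X -> A) : set X := [set x | f x != 0].

Definition compactly_supported : {pred (X -> A)} := fun f =>
  `[< continuous (f : X -> discrete_topology A) /\ compact (closure (fsupp f)) >].

Fact compactly_supported_zmod_closed : zmod_closed compactly_supported.
Proof.
split=> [|f g].
  apply/asboolP; split; first exact: cst_continuous.
  rewrite (_ : fsupp 0 = set0) ?closure0; first exact: compact0.
  by rewrite -subset0 => x; rewrite /fsupp /= eqxx.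
move=> /asboolP[cf kf] /asboolP[cg kg]; apply/asboolP; split.
  move=> x; have /(_ _ _)/= nf := cf x; have /(_ _ _)/= ng := cg x.
  have ff : nbhs x [set y | f y = f x].
    by apply: (nf [set f x]); exact/principal_filterP.
  have gg : nbhs x [set y | g y = g x].
    by apply: (ng [set g x]); exact/principal_filterP.
  move=> B /principal_filterP Bx; apply: filterS (filterI ff gg).
  by move=> y [/= fy gy]; move: Bx; rewrite /= !fctE fy gy.
apply: (subclosed_compact _ (compactU kf kg)); first exact: closed_closure.
rewrite -closureU; apply: closure_subset => x; rewrite /fsupp/= !fctE.
case: (eqVneq (f x) 0) => [->|]; last by left.
by rewrite sub0r oppr_eq0; right.
Qed.

HB.instance Definition _ :=
  GRing.isZmodClosed.Build (X -> A) compactly_supported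
    compactly_supported_zmod_closed.

Record Cc := MkCc { Cc_fun :> X -> A; _ : Cc_fun \in compactly_supported }.

HB.instance Definition _ := [isSub for Cc_fun].
HB.instance Definition _ := [Choice of Cc by <:].
HB.instance Definition _ := [SubChoice_isSubZmodule of Cc by <:].

End CompactSupport.

(* The sum is over the points of the fibre where f is nonzero, and is set to 0
   if there are infinitely many. There are finitely many when p is a local
   homeomorphism of Hausdorff spaces and f is compactly supported. *)
Definition pushforward (X Y : topologicalType) (A : zmodType) (p : X -> Y)
  (f : X -> A) : Y -> A := fun y => \sum_(x \in p @^-1` [set y]) f x.

Definition extension_by_zero (X Y : Type) (A : zmodType) (p : X -> Y)
    (f : X -> A) (g : Y -> A) : Prop :=
  (forall x, g (p x) = f x) /\ (forall y, ~ range p y -> g y = 0).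

Record chain_complex := ChainComplex {
  ch_obj :> nat -> zmodType;
  ch_d : forall n, {additive ch_obj n.+1 -> ch_obj n};
  ch_dd : forall n (x : ch_obj n.+2), ch_d n (ch_d n.+1 x) = 0
}.

Record chain_map (C D : chain_complex) := ChainMap {
  ch_map :> forall n, {additive C n -> D n};
  ch_mapd : forall n (x : C n.+1), ch_map n (ch_d C n x) = ch_d D n (ch_map n.+1 x)
}.

Definition chain_isomorphism (C D : chain_complex) (f : chain_map C D) : Prop :=
  forall n, bijective (f n).

Definition short_exact (C D E : chain_complex)
    (f : chain_map C D) (g : chain_map D E) : Prop :=
  forall n, [/\ injective (f n), range (f n) = [set y | g n y = 0] &
                range (g n) = [set: E n]].

Section QuotientComplex.
Context (C D : chain_complex) (f : chain_map C D).
Local Open Scope quotient_scope.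

Definition im_pred n : {pred D n} := fun y => `[< range (f n) y >].

Fact im_zmod_closed n : zmod_closed (@im_pred n).
Proof.
split=> [|x y /asboolP[u _ <-] /asboolP[v _ <-]]; apply/asboolP.
  by exists 0 => //; rewrite raddf0.
by exists (u - v) => //; rewrite raddfB.
Qed.

HB.instance Definition _ n :=
  GRing.isZmodClosed.Build (D n) (@im_pred n) (im_zmod_closed n).

Definition quot_obj n : zmodType := Quotient.quot (@im_pred n).

Definition quot_pi n (x : D n) : quot_obj n := \pi_(Quotient.quot (@im_pred n)) x.

Fact quot_pi_additive n : zmod_morphism (@quot_pi n).
Proof. by move=> x y; rewrite /quot_pi !piE. Qed.

HB.instance Definition _ n :=
  GRing.isZmodMorphism.Build (D n) (quot_obj n) (@quot_pi n)
    (@quot_pi_additive n).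

Lemma quot_piP n (x y : D n) : quot_pi x = quot_pi y <-> range (f n) (x - y).
Proof.
split=> [/eqP|xy].
  by rewrite /quot_pi -Quotient.idealrBE => /asboolP.
by apply/eqP; rewrite /quot_pi -Quotient.idealrBE; apply/asboolP.
Qed.

Definition quot_d n (q : quot_obj n.+1) : quot_obj n :=
  quot_pi (ch_d D n (repr q)).

Lemma quot_dE n (x : D n.+1) : quot_d (quot_pi x) = quot_pi (ch_d D n x).
Proof.
apply/quot_piP; rewrite -raddfB.
have [u _ <-] : range (f n.+1) (repr (quot_pi x) - x).
  by apply/quot_piP; rewrite /quot_pi reprK.
by exists (ch_d C n u) => //; rewrite ch_mapd.
Qed.

Lemma quot_pi_surj n (q : quot_obj n) : exists x, q = quot_pi x.
Proof. by exists (repr q); rewrite /quot_pi reprK. Qed.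

Fact quot_d_additive n : zmod_morphism (@quot_d n).
Proof.
move=> p q; have [x ->] := quot_pi_surj p; have [y ->] := quot_pi_surj q.
by rewrite -raddfB !quot_dE -raddfB -raddfB.
Qed.

HB.instance Definition _ n :=
  GRing.isZmodMorphism.Build (quot_obj n.+1) (quot_obj n) (@quot_d n)
    (@quot_d_additive n).

Fact quot_dd n (q : quot_obj n.+2) : quot_d (quot_d q) = 0.
Proof.
by have [x ->] := quot_pi_surj q; rewrite !quot_dE ch_dd raddf0.
Qed.

Definition quotient_complex : chain_complex :=
  @ChainComplex quot_obj (fun n => @quot_d n) quot_dd.

Definition quotient_map : chain_map D quotient_complex :=
  @ChainMap D quotient_complex (fun n => @quot_pi n)
    (fun n x => esym (quot_dE x)).

End QuotientComplex.

Section GroupoidComplex.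
Context (G : groupoidSpaceType) (A : zmodType).

Definition boundary n (f : nerve G n.+1 -> A) : nerve G n -> A :=
  fun y => \sum_(i < n.+2) pushforward (face i) f y *~ (-1) ^+ i.

(* Evidence that the formula above makes (C_c(G^(n), A))_n into a chain complex;
   it exists for etale groupoids and is determined by G and A. *)
Record groupoid_differential := GroupoidDifferential {
  gd_d : forall n, {additive Cc (nerve G n.+1) A -> Cc (nerve G n) A};
  gd_boundary : forall n f y, gd_d n f y = boundary f y;
  gd_dd : forall n f, gd_d n (gd_d n.+1 f) = 0
}.

Definition groupoid_complex (d : groupoid_differential) : chain_complex :=
  @ChainComplex (fun n => Cc (nerve G n) A) (gd_d d) (gd_dd d).

End GroupoidComplex.

(* The finest topology on Y making f : X -> Y continuous; for f surjective this
   is the quotient topology. *)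
Definition final_topology (X Y : Type) (f : X -> Y) : Type := Y.

Section FinalTopology.
Context (X : topologicalType) (Y : choiceType) (f : X -> Y).
Local Notation T := (final_topology f).

Definition final_open : set (set T) := [set U | open (f @^-1` U)].

Fact final_openT : final_open setT.
Proof. exact: openT. Qed.

Fact final_openI : setI_closed final_open.
Proof. by move=> U V; exact: openI. Qed.

Fact final_open_bigU (I : Type) (U : I -> set T) :
  (forall i, final_open (U i)) -> final_open (\bigcup_i U i).
Proof. by move=> oU; apply: bigcup_open => i _; exact: oU. Qed.

HB.instance Definition _ := Choice.copy T Y.
HB.instance Definition _ :=
  isOpenTopological.Build T final_openT final_openI final_open_bigU.

End FinalTopology.

Section Regular.
Context (G : groupoidSpaceType) (G' : subgroupoid G).

Definition Delta : set G := ~` G'.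
Definition rDelta : set G := grng @` Delta.

Fact Delta_rng (d : Delta) : rDelta (grng (val d)).
Proof. by exists (val d) => //; exact: set_valP. Qed.

Fact Delta_inv g : Delta g -> Delta (ginv g).
Proof. by move=> Dg /sg_inv; rewrite ginvK. Qed.

Definition rng_Delta (d : Delta) : rDelta := SigSub (mem_set (Delta_rng d)).

Definition regular_inclusion : Prop :=
  forall U : set Delta, open U ->
    open (rng_Delta @` U : set (final_topology rng_Delta)).

Definition H_sub : subgroupoid G := reduction (fullg G) rDelta.
Definition H'_sub : subgroupoid G := reduction G' rDelta.

Definition Delta_pairs : set (G * G) :=
  [set p | [/\ gcomp p.1 p.2, Delta p.1, Delta p.2 & sg_set G' (gmul p.1 p.2)]].

Fact Delta_pairs_mul (p : Delta_pairs) :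
  sg_set H'_sub (gmul (val p).1 (val p).2).
Proof.
have [c D1 D2 G'p] := set_valP p; split => //.
  by rewrite grngM//; exists (val p).1.
by rewrite gsrcM//; exists (ginv (val p).2); rewrite ?grngV//; exact: Delta_inv.
Qed.

Definition Delta_mul (p : Delta_pairs) : H'_sub :=
  SigSub (mem_set (Delta_pairs_mul p)).

(* H' carries the quotient topology along (g, h) |-> g h from the composable
   pairs in Delta * Delta with product in G', not the relative topology. *)
Definition H'_space : Type := final_topology Delta_mul.

HB.instance Definition _ := Topological.copy H'_space (final_topology Delta_mul).
HB.instance Definition _ := Groupoid.copy H'_space (set_type H'_sub).

Fact H'_sub_H (h : H'_sub) : sg_set H_sub (val h).
Proof. by have [_ ? ?] := set_valP h. Qed.

Fact Delta_H (d : Delta) : sg_set H_sub (val d).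
Proof.
split=> //; first exact: Delta_rng.
rewrite -grngV; exists (ginv (val d)) => //.
by apply: Delta_inv; exact: set_valP.
Qed.

Definition H'_to_H (h : H'_space) : H_sub := SigSub (mem_set (H'_sub_H h)).
Definition Delta_to_H (d : Delta) : H_sub := SigSub (mem_set (Delta_H d)).

Definition H_space : Type := set_type H_sub.

(* The disjoint union topology for H = H' + Delta; in general it is finer than
   the relative topology from G. *)
Definition H_open : set (set H_space) :=
  [set U | open (H'_to_H @^-1` U) /\ open (Delta_to_H @^-1` U)].

Fact H_openT : H_open setT.
Proof. by split; exact: openT. Qed.

Fact H_openI : setI_closed H_open.
Proof. by move=> U V [? ?] [? ?]; split; exact: openI. Qed.

Fact H_open_bigU (I : Type) (U : I -> set H_space) :
  (forall i, H_open (U i)) -> H_open (\bigcup_i U i).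
Proof.
by move=> oU; split; apply: bigcup_open => i _; have [] := oU i.
Qed.

HB.instance Definition _ := Choice.copy H_space (set_type H_sub).
HB.instance Definition _ :=
  isOpenTopological.Build H_space H_openT H_openI H_open_bigU.
HB.instance Definition _ := Groupoid.copy H_space (set_type H_sub).

Fact H'_to_H_inv (h : H'_space) :
  H'_to_H (ginv h) = ginv (H'_to_H h : H_space).
Proof. exact: val_inj. Qed.

Fact H'_to_H_mul (g h : H'_space) : gcomp g h ->
  H'_to_H (gmul g h) = gmul (H'_to_H g : H_space) (H'_to_H h : H_space).
Proof.
move=> /sg_gcomp gh; apply: val_inj => /=.
transitivity (gmul (val g) (val h)); first exact: val_sgM.
by apply/esym; exact: val_sgM.
Qed.

Definition H'_incl : groupoid_hom H'_space H_space :=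
  GroupoidHom H'_to_H_inv H'_to_H_mul.

Definition H_incl : groupoid_hom H_space G := sg_incl H_sub.

End Regular.

(* Main.v *)
Require Import Defs.
From HB Require Import structures.
From mathcomp Require Import all_boot all_order all_algebra.
From mathcomp Require Import all_classical.
From mathcomp Require Import topology_structure discrete_topology product_topology.
From mathcomp Require Import function_spaces subspace_topology subtype_topology.
From mathcomp Require Import compact connected separation_axioms.
From mathcomp Require Import initial_topology supremum_topology zify.

Set Implicit Arguments.
Unset Strict Implicit.
Unset Printing Implicit Defensive.
Import GRing.Theory.
Local Open Scope classical_set_scope.
Local Open Scope ring_scope.

(** Write D for Delta, Y for r(D) with its quotient topology, iota for the
    inclusion of H in G, and call complement in degree n the part of the n-th
    nerve of G (or H) outside the nerve of G' (or H'). Both quotient complexes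
    are complexes of compactly supported locally constant functions on their
    complements, and the two complements are the same space.

    The differentials exist for every ample groupoid, that is, every étale
    groupoid whose topology has a base of clopen sets: all face maps are local
    homeomorphisms ([face_etale]), direct images along local homeomorphisms
    preserve compactly supported functions ([pushforward_Cc]) and compose
    ([pushforward_comp]), and the simplicial identities do the rest
    ([face_face], [simplicial_cancellation]). An open embedding of ample
    groupoids induces open embeddings of nerves, along which the direct image
    is extension by zero; so it is a chain map by functoriality, it is
    injective, and its image consists of the chains vanishing on the complement
    ([nerve_chain_map_range]).

    G is ample because a locally compact totally disconnected Hausdorff space
    has a base of compact open sets ([totally_disconnected_compact_open_base]).
    For H the point is that its topology, defined by gluing, is the coarsest
    one making iota : H -> G and r : H -> Y continuous ([nbhs_H]); this is
    where regularity enters, in the form that r maps open subsets of D to open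
    subsets of Y. It makes H ample, and H' is open in H.

    A composable tuple with one arrow in D has all its ranges and sources in Y,
    because Y is invariant; hence the two complements agree as sets
    ([nerve_compl_image]). Their topologies agree as well
    ([nerve_compl_H_nbhs]): if tuples of the complement converge in G and their
    k-th arrows lie in D, the ranges of these arrows converge in Y, and since
    both r and s are continuous from H to Y the convergence spreads along the
    tuple from one vertex to the next; by the description of the topology of H
    the tuples then converge in H.

    Consequently a chain f of G restricts to the complement and extends by zero
    over the clopen nerve of H' ([agree_exists_H]); conversely a chain h of H,
    restricted to the complement, extends to the nerve of G because this has a
    base of compact open sets ([Cc_extension], [agree_exists_G]). Agreement on
    the complement is thus a correspondence between chains of G and chains of H
    that is total on both sides, additive, compatible with the differentials
    ([agree_boundary]), and whose indeterminacy is exactly what the two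
    quotients kill ([agree_quotient]): it is the graph of the required
    isomorphism. *)

(** * Compact open sets in locally compact spaces *)

Section PointSet.
Implicit Types X Y Z : topologicalType.

Definition clopen_base X := forall (x : X) W, nbhs x W ->
  exists U : set X, [/\ clopen U, U x & U `<=` W].

Definition compact_open_base X := forall (x : X) W, nbhs x W ->
  exists U : set X, [/\ open U, compact U, U x & U `<=` W].

(** Local homeomorphisms, without reference to local inverses: direct images
    only use openness and local injectivity. *)
Definition etale_map X Y (p : X -> Y) : Prop :=
  [/\ continuous p, forall (x : X) U, nbhs x U -> nbhs (p x) (p @` U) &
      forall x : X, exists2 U, nbhs x U & set_inj U p].

Lemma nbhs_open X (U : set X) x : open U -> U x -> nbhs x U.
Proof. by move=> oU Ux; exact: open_nbhs_nbhs. Qed.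

Lemma open_nbhs_all X (U : set X) : (forall x, U x -> nbhs x U) -> open U.
Proof. by rewrite openE. Qed.

Lemma nbhs_open_sub X (W : set X) x : nbhs x W ->
  exists U, [/\ open U, U x & U `<=` W].
Proof. by rewrite nbhsE => -[U [oU Ux] UW]; exists U. Qed.

Lemma nbhs_preimage X Y (f : X -> Y) x W : continuous f -> nbhs (f x) W ->
  nbhs x (f @^-1` W).
Proof. by move=> cf xW; exact: cf xW. Qed.

Lemma preimage_continuous X Y (f : X -> Y) :
  (forall x W, nbhs (f x) W -> nbhs x (f @^-1` W)) -> continuous f.
Proof. by move=> cf x W xW; exact: cf xW. Qed.

Lemma nbhs_setI X (x : X) U V : nbhs x U -> nbhs x V -> nbhs x (U `&` V).
Proof. exact: filterI. Qed.

Lemma nbhs_subset X (x : X) (U V : set X) : U `<=` V -> nbhs x U -> nbhs x V.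
Proof. exact: filterS. Qed.

Lemma nbhs_forall X (I : finType) (U : I -> set X) (x : X) :
  (forall i, nbhs x (U i)) -> nbhs x [set y | forall i, U i y].
Proof. exact: filter_forall. Qed.

Lemma nbhs_setT X (x : X) : nbhs x setT.
Proof. exact: filterT. Qed.

Lemma compact_open_base_clopen X :
  hausdorff_space X -> compact_open_base X -> clopen_base X.
Proof.
move=> hX cX x W /cX[U [oU cU Ux UW]]; exists U; split=> //.
by split=> //; exact: compact_closed.
Qed.

(** Otherwise the sets B with P (K `\` B) form a proper filter; it has a
    cluster point x in K, and this contradicts P for a neighbourhood of x. All
    arguments by finite subcovers below are instances of this induction. *)
Lemma compact_ind X (P : set X -> Prop) (K : set X) :
  P set0 -> (forall A B, P A -> P B -> P (A `|` B)) ->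
  (forall A B, A `<=` B -> P B -> P A) ->
  (forall x, K x -> exists2 U, nbhs x U & P U) -> compact K -> P K.
Proof.
move=> P0 PU PS Pl cK; apply: contrapT => nPK.
pose F : set_system X := [set B | P (K `\` B)].
have FF : ProperFilter F.
  apply: Build_ProperFilter_ex.
    move=> B FB; apply: contrapT => nB; apply: nPK; apply: PS FB.
    by move=> x Kx; split=> // Bx; apply: nB; exists x.
  split; rewrite /F /=.
  - by rewrite setDT.
  - by move=> A B PA PB; have := PU _ _ PA PB; rewrite -setDIr.
  - by move=> A B AB; apply: PS => x [Kx nBx]; split=> // /AB.
have [x [Kx clx]] : K `&` cluster F !=set0 by apply: cK; rewrite /F /= setDv.
have [U xU PUU] := Pl x Kx.
have /(_ (~` U) U)[||y []] := clx => //.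
by rewrite /F /=; apply: PS PUU => y [_]; rewrite /= notK.
Qed.

Lemma hausdorff_neq_nbhs X (x y : X) : hausdorff_space X -> x <> y ->
  exists U V, [/\ nbhs x U, nbhs y V & U `&` V `<=` set0].
Proof.
move=> hX xy; apply: contrapT => nUV; apply: xy; apply: hX => U V xU yV.
apply: contrapT => n0; apply: nUV; exists U, V; split=> // z zUV.
by apply: n0; exists z.
Qed.


Lemma compact_point_separation X (B : set X) x : hausdorff_space X ->
  compact B -> ~ B x ->
  exists U V, [/\ open U, open V, U x, B `<=` V & U `&` V `<=` set0].
Proof.
move=> hX cB nBx.
pose P B := exists U V : set X,
  [/\ open U, open V, U x, B `<=` V & U `&` V `<=` set0].
apply: (@compact_ind X P) cB.
- by exists setT, set0; split; rewrite ?setI0 //; [exact: openT|exact: open0].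
- move=> C D [U [V [oU oV xU CV UV]]] [U' [V' [oU' oV' xU' DV' UV']]].
  exists (U `&` U'), (V `|` V'); split=> //; [exact: openI|exact: openU| |].
    by move=> y [/CV|/DV']; [left|right].
  by move=> y [[Uy Uy'] [Vy|Vy]]; [apply: (UV y)|apply: (UV' y)].
- move=> C D CD [U [V [oU oV xU DV UV]]]; exists U, V; split=> //.
  exact: subset_trans DV.
- move=> y By; have [|U [V []]] := @hausdorff_neq_nbhs _ x y hX.
    by move=> xy; apply: nBx; rewrite xy.
  rewrite !nbhsE => -[U' [oU' xU'] UU'] [V' [oV' yV'] VV'] UV.
  exists V'; first by exists V'.
  by exists U', V'; split=> // z [/UU' ? /VV' ?]; apply: (UV z).
Qed.

Lemma compact_separation X (A B : set X) : hausdorff_space X ->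
  compact A -> compact B -> A `&` B `<=` set0 ->
  exists U V, [/\ open U, open V, A `<=` U, B `<=` V & U `&` V `<=` set0].
Proof.
move=> hX cA cB AB.
pose P A := exists U V : set X,
  [/\ open U, open V, A `<=` U, B `<=` V & U `&` V `<=` set0].
apply: (@compact_ind X P) cA.
- by exists set0, setT; split; rewrite ?set0I //; [exact: open0|exact: openT].
- move=> C D [U [V [oU oV CU BV UV]]] [U' [V' [oU' oV' DU' BV' UV']]].
  exists (U `|` U'), (V `&` V'); split=> //; [exact: openU|exact: openI| | |].
  + by move=> y [/CU|/DU']; [left|right].
  + by move=> y By; split; [exact: BV|exact: BV'].
  + by move=> y [[Uy|Uy] [Vy Vy']]; [apply: (UV y)|apply: (UV' y)].
- move=> C D CD [U [V [oU oV DU BV UV]]]; exists U, V; split=> //.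
  exact: subset_trans DU.
- move=> y Ay; have [|U [V [oU oV yU BV UV]]] :=
    @compact_point_separation _ B y hX cB.
    by move=> By; apply: (AB y).
  by exists U; [exact: open_nbhs_nbhs (conj oU yU)|exists U, V; split].
Qed.

(** In a compact neighbourhood C of x the quasi-component Q of x, the
    intersection of the relatively clopen subsets of C containing x, is
    connected: two disjoint closed pieces of Q could be separated by open sets,
    and by compactness a relatively clopen subset of C would already split
    along them. So Q is the point x, and by compactness again some relatively
    clopen subset of C containing x lies in the interior of C and in any given
    neighbourhood of x. *)
Lemma totally_disconnected_compact_open_base X : hausdorff_space X ->
  locally_compact [set: X] -> totally_disconnected [set: X] ->
  compact_open_base X.
Proof.
move=> hX lcX tdX x W xW.
have [C] := lcX x I; rewrite withinET => xC [cC _].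
have clC := compact_closed hX cC.
pose relclopen D := [/\ D `<=` C, closed D, closed (C `\` D) & D x].
have rC : relclopen C.
  split=> //; last exact: nbhs_singleton.
  by rewrite setDv; exact: closed0.
have rI D E : relclopen D -> relclopen E -> relclopen (D `&` E).
  move=> [DC clD clD' Dx] [EC clE clE' Ex]; split=> //.
  - by move=> y [/DC].
  - exact: closedI.
  - by rewrite setDIr; exact: closedU.
pose Q := [set y | forall D, relclopen D -> D y].
(* The relatively clopen sets are stable under intersection, so one suffices.
   *)
have Qsep K : compact K -> Q `&` K `<=` set0 ->
    exists2 D, relclopen D & D `&` K `<=` set0.
  move=> cK QK.
  apply: (@compact_ind X (fun K => exists2 D, relclopen D & D `&` K `<=` set0))
    cK.
  - by exists C => //; rewrite setI0.
  - move=> A B [D rD DA] [E rE EB]; exists (D `&` E); first exact: rI.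
    by move=> y [[Dy Ey] [Ay|By]]; [apply: (DA y)|apply: (EB y)].
  - move=> A B AB [D rD DB]; exists D => // y [Dy /AB By].
    exact: (DB y).
  - move=> y Ky; have /existsNP[D /not_implyP[rD nDy]] : ~ Q y.
      by move=> Qy; apply: (QK y).
    exists (~` D); last by exists D => //; rewrite setICr.
    by have [_ clD _ _] := rD; apply: open_nbhs_nbhs; split=> //;
      exact: closed_openC.
have Qx : Q x by move=> D [].
have QC : Q `<=` C by move=> y; exact.
have clQ : closed Q.
  rewrite (_ : Q = \bigcap_(D in relclopen) D).
    by apply: closed_bigI => D [].
  by apply/seteqP; split=> y /=.
have conQ : connected Q.
  apply: contrapT => /connectedPn[E [E0 QE [sE1 sE2]]].
  have cE b : compact (E b).
    apply: (subclosed_compact _ cC); last first.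
      by move=> y Ey; apply: QC; rewrite QE; case: b Ey; [right|left].
    move=> y Ey.
    have Qy : Q y.
      apply: clQ; apply: (closureS _ Ey) => z Ez.
      by rewrite QE; case: b {Ey} Ez; [right|left].
    move: Qy Ey; rewrite QE => -[] Ey; case: b => // Ey'.
      have : (E false `&` closure (E true)) y by [].
      by rewrite sE2.
    have : (closure (E false) `&` E true) y by [].
    by rewrite sE1.
  have [|U [V [oU oV EU EV UV]]] := compact_separation hX (cE false) (cE true).
    by move=> y [Ef Et]; rewrite -sE1; split=> //; exact: subset_closure.
  have [||D rD DUV] := Qsep (C `\` (U `|` V)).
  - apply: compact_closedI => //.
    exact/open_closedC/openU.
  - move=> y [+ [_ nUV]]; rewrite QE => -[/EU|/EV] ?; apply: nUV.
      by left.
    by right.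
  have {}DUV : D `<=` U `|` V.
    move=> y Dy; apply: contrapT => nUV; apply: (DUV y); split=> //.
    by have [DC _ _ _] := rD; split=> //; exact: DC.
  (* The part of D inside one of two separating sets is again relatively
     clopen. *)
  have split_D U' V' : open U' -> open V' -> U' `&` V' `<=` set0 ->
      D `<=` U' `|` V' -> U' x -> Q `<=` U'.
    move=> oU' oV' UV' DUV' Ux y; have [DC clD clCD Dx] := rD.
    suff : relclopen (D `&` U') by move=> r /(_ _ r)[].
    split=> //; first by move=> z [/DC].
      rewrite (_ : _ `&` _ = D `&` ~` V'); first by apply: closedI => //;
        exact: open_closedC.
      apply/seteqP; split=> z [Dz]; last by move: (DUV' _ Dz) => [].
      by move=> Uz; split=> // Vz; apply: (UV' z).
    rewrite setDIr; apply: closedU => //.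
    rewrite setDE; by apply: closedI => //; exact: open_closedC.
  move: Qx; rewrite QE => -[Ex|Ex].
    have [y Ey] := E0 true; apply: (UV y); split; last exact: EV.
    apply: (split_D U V) => //; first exact: EU.
    by rewrite QE; right.
  have [y Ey] := E0 false; apply: (UV y); split; first exact: EU.
  apply: (split_D V U) => //; first by rewrite setIC.
  - by rewrite setUC.
  - exact: EV.
  - by rewrite QE; left.
have Q1 y : Q y -> y = x.
  move=> Qy; have : connected_component [set: X] x y.
    by apply: (connected_component_max Qx) => //.
  by rewrite tdX.
pose O := interior (W `&` C).
have [||D rD DO] := Qsep (C `\` O).
- by apply: compact_closedI => //; apply/open_closedC; exact: open_interior.
- move=> y [/Q1 -> [_]]; apply.
  by rewrite /O /interior; exact: filterI.
have [DC clD clCD Dx] := rD.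
have {}DO : D `<=` O.
  move=> y Dy; apply: contrapT => nO; apply: (DO y); split=> //.
  by split=> //; exact: DC.
exists D; split=> //.
- rewrite (_ : D = O `&` ~` (C `\` D)).
    by apply: openI; [exact: open_interior|exact: closed_openC].
  apply/seteqP; split=> y; first by move=> Dy; split; [exact: DO|case].
  move=> [Oy nCD]; apply: contrapT => nDy; apply: nCD; split=> //.
  by have [] := interior_subset Oy.
- exact: (subclosed_compact clD cC).
- by move=> y /DO/interior_subset[].
Qed.

(** Compactness passes backwards along a map e whose restriction to D is a
    homeomorphism onto its image. *)
Lemma compact_preimage_embedding X Z (e : X -> Z) (D : set X) (K : set Z) :
  (forall x W, D x -> nbhs x W ->
     exists2 N, nbhs (e x) N & forall y, D y -> N (e y) -> W y) ->
  K `<=` e @` D -> compact K -> compact (D `&` e @^-1` K).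
Proof.
move=> eD KD cK F FF FK.
have [|z [Kz clz]] := cK (e @ F) _.
  by rewrite /fmap /=; apply: filterS FK => x [].
have [x Dx exz] := KD _ Kz; exists x; split; first by split=> //=; rewrite exz.
move=> B W FB /(eD x W Dx)[N xN NW].
have [||_ [[y [By [Dy _]] <-] Ny]] := clz (e @` (B `&` (D `&` e @^-1` K))) N.
- rewrite /fmap /=; apply: (filterS _ (filterI FB FK)) => y yB.
  by exists y.
- by rewrite -exz.
by exists y; split=> //; exact: NW.
Qed.

End PointSet.

(** * Locally constant functions with compact support *)

Section CompactlySupported.
Implicit Types X Y Z : topologicalType.
Variable A : zmodType.

Definition locally_constant X (f : X -> A) :=
  forall x : X, nbhs x [set y | f y = f x].

Lemma locally_constantP X (f : X -> A) :
  continuous (f : X -> discrete_topology A) <-> locally_constant f.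
Proof.
split=> cf x.
  by apply: (cf x [set a | a = f x]); exact/principal_filterP.
move=> B /principal_filterP Bx; apply: filterS (cf x) => y /= fy.
by move: Bx; rewrite /= fy.
Qed.

Lemma locally_constant_clopen X (f : X -> A) (B : set A) :
  locally_constant f -> clopen (f @^-1` B).
Proof.
move=> /locally_constantP cf; split.
  have /continuousP := cf; apply; exact: discrete_open.
have /continuous_closedP := cf; apply; exact: discrete_closed.
Qed.

Lemma fsupp_clopen X (f : X -> A) : locally_constant f -> clopen (fsupp f).
Proof. exact: (@locally_constant_clopen _ _ [set a | a != 0]). Qed.

Lemma compactly_supportedP X (f : X -> A) :
  reflect (locally_constant f /\ compact (fsupp f))
    (f \in @compactly_supported X A).
Proof.
apply: (iffP (asboolP _)) => [[/locally_constantP cf]|[cf]].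
  by have /closure_id <- := (fsupp_clopen cf).2.
move=> kf; split; first exact/locally_constantP.
by have /closure_id <- := (fsupp_clopen cf).2.
Qed.

Lemma Cc_inj X (f g : Cc X A) : (forall x, f x = g x) -> f = g.
Proof. by move=> fg; apply: val_inj; apply/funext. Qed.

Lemma Cc_locally_constant X (f : Cc X A) : locally_constant f.
Proof. by case: f => f /= /compactly_supportedP[]. Qed.

Lemma Cc_compact X (f : Cc X A) : compact (fsupp f).
Proof. by case: f => f /= /compactly_supportedP[]. Qed.

Lemma CcB X (f g : Cc X A) x : (f - g) x = f x - g x.
Proof. by []. Qed.

(** Cutting off a function at a clopen set keeps it compactly supported, which
    is what makes inductions over coverings by clopen sets work. *)
Definition cutoff X (U : set X) (f : X -> A) : X -> A :=
  fun x => if x \in U then f x else 0.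

Lemma cutoff_in X (U : set X) (f : X -> A) x : U x -> cutoff U f x = f x.
Proof. by move=> /mem_set Ux; rewrite /cutoff Ux. Qed.

Lemma cutoff_out X (U : set X) (f : X -> A) x : ~ U x -> cutoff U f x = 0.
Proof. by move=> nUx; rewrite /cutoff memNset. Qed.

Lemma fsupp_cutoff X (U : set X) (f : X -> A) :
  fsupp (cutoff U f) = fsupp f `&` U.
Proof.
apply/seteqP; rewrite /fsupp; split=> x /=.
  have [Ux|nUx] := pselect (U x); first by rewrite cutoff_in.
  by rewrite cutoff_out// eqxx.
by move=> [? ?]; rewrite cutoff_in.
Qed.

Lemma cutoff_locally_constant X (U : set X) (f : X -> A) : clopen U ->
  locally_constant f -> locally_constant (cutoff U f).
Proof.
move=> [oU cU] cf x; have [Ux|nUx] := pselect (U x).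
  apply: filterS (filterI (nbhs_open oU Ux) (cf x)) => y [Uy fy] /=.
  by rewrite !cutoff_in.
apply: filterS (nbhs_open (closed_openC cU) nUx) => y nUy /=.
by rewrite !cutoff_out.
Qed.

Lemma cutoff_Cc X (U : set X) (f : X -> A) : clopen U ->
  f \in @compactly_supported X A -> cutoff U f \in @compactly_supported X A.
Proof.
move=> cU /compactly_supportedP[cf kf]; apply/compactly_supportedP.
split; first exact: cutoff_locally_constant.
by rewrite fsupp_cutoff; apply: compact_closedI => //; exact: cU.2.
Qed.

Lemma cutoffD X (U : set X) (f : X -> A) : f = cutoff U f + cutoff (~` U) f.
Proof.
apply/funext => x; rewrite !fctE; have [Ux|nUx] := pselect (U x).
  by rewrite cutoff_in// cutoff_out ?addr0//; exact.
by rewrite cutoff_out// cutoff_in ?add0r.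
Qed.

(** ** Direct images *)

Definition fibre_finite X Y (p : X -> Y) (f : X -> A) :=
  forall y, finite_set (fsupp f `&` p @^-1` [set y]).

(** Fibres of a local homeomorphism are discrete, so they meet compact sets in
    finite sets. *)
Lemma etale_map_fibre_finite X Y (p : X -> Y) (f : X -> A) : etale_map p ->
  compact (fsupp f) -> fibre_finite p f.
Proof.
move=> [_ _ injp] kf y.
apply: (@compact_ind X (fun K => finite_set (K `&` p @^-1` [set y]))) kf.
- by rewrite set0I; exact: finite_set0.
- by move=> B C fB fC; rewrite setIUl finite_setU.
- move=> B C BC; apply: sub_finite_set; exact: setSI.
- move=> x _; have [U xU pU] := injp x; exists U => //.
  have [->|/set0P[z [Uz pz]]] := eqVneq (U `&` p @^-1` [set y]) set0.
    exact: finite_set0.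
  apply: (@sub_finite_set _ _ [set z]); last exact: finite_set1.
  move=> t [Ut pt] /=; apply: pU; rewrite ?inE//.
  by rewrite pt pz.
Qed.

(** Sums over fibres are 0 by convention when the support is infinite, and only
    see the support: any set between it and the fibre will do. *)
Lemma pushforward_widen X Y (p : X -> Y) (f : X -> A) y (S : set X) :
  fsupp f `&` p @^-1` [set y] `<=` S -> S `<=` p @^-1` [set y] ->
  pushforward p f y = \sum_(x \in S) f x.
Proof.
move=> fS Sy; rewrite /pushforward; apply/esym/fsbig_widen => // x [py nSx] /=.
by apply: contrapT => /eqP fx; apply: nSx; apply: fS.
Qed.

Lemma pushforwardB X Y (p : X -> Y) (f g : X -> A) :
  fibre_finite p f -> fibre_finite p g ->
  pushforward p (f - g) = pushforward p f - pushforward p g.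
Proof.
move=> pf pg; apply/funext => y; rewrite !fctE.
pose S := fsupp f `&` p @^-1` [set y] `|` fsupp g `&` p @^-1` [set y].
have fS : finite_set S by rewrite finite_setU.
have Sy : S `<=` p @^-1` [set y] by move=> x [[]|[]].
rewrite !(@pushforward_widen _ _ p _ y S)//.
- by rewrite !fsbig_finite//= -sumrB.
- by move=> x ?; right.
- by move=> x ?; left.
- move=> x [fgx px]; rewrite /S /fsupp /=.
  have [fx|fx] := eqVneq (f x) 0; last by left.
  right; split=> //; apply: contraNneq fgx => gx.
  by rewrite fx gx subrr.
Qed.

(** A sum over a fibre of the composite is grouped by the images under q. *)
Lemma pushforward_comp X Y Z (p : Y -> Z) (q : X -> Y) (f : X -> A) :
  fibre_finite (p \o q) f ->
  pushforward p (pushforward q f) = pushforward (p \o q) f.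
Proof.
move=> pqf; apply/funext => z.
pose S := fsupp f `&` (p \o q) @^-1` [set z].
have fS : finite_set S by exact: pqf.
rewrite [RHS](@pushforward_widen _ _ _ _ _ S)//; last exact: subIsetr.
have fT : finite_set (q @` S) by exact: finite_image.
have E y : (q @` S) y ->
    pushforward q f y = \sum_(x \in S) if q x == y then f x else 0.
  move=> [x0 [_ /= qx0]] <-.
  rewrite (@pushforward_widen _ _ _ _ _ (S `&` q @^-1` [set q x0])).
  - rewrite setIC fsbig_mkcondl; apply: eq_fsbigr => x _.
    by congr (if _ then _ else _); apply/idP/eqP; rewrite inE.
  - by move=> x [fx qx]; split=> //; split=> //=; rewrite qx.
  - by move=> x [].
rewrite (@pushforward_widen _ _ _ _ _ (q @` S)).
- transitivity (\sum_(y \in q @` S) \sum_(x \in S) if q x == y then f x else 0).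
    by apply: eq_fsbigr => y /set_mem; exact: E.
  rewrite exchange_fsbig//; apply: eq_fsbigr => x /set_mem Sx.
  rewrite -(@fsbig_widen _ _ _ _ [set q x])//.
  + by rewrite fsbig_set1 eqxx.
  + by move=> _ ->; exists x.
  + by move=> y [_ /= nqx]; rewrite ifN//; apply/eqP => qx; apply: nqx.
- move=> y [fy /= py]; have [x [qx fx]] : exists x, q x = y /\ f x != 0.
    apply: contrapT => nx; move: fy; rewrite /fsupp /= /pushforward.
    rewrite fsbig1 ?eqxx// => x qx; apply: contrapT => /eqP fx.
    by apply: nx; exists x.
  by exists x => //; split=> //=; rewrite qx.
- by move=> _ [x [_ /= px] <-].
Qed.

(** Where f is supported on a set on which p is injective, the direct image just
    transports the values of f. *)
Lemma pushforward_inj_Cc X Y (p : X -> Y) (f : X -> A) (U : set X) :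
  hausdorff_space Y -> etale_map p -> set_inj U p ->
  fsupp f `<=` U -> f \in @compactly_supported X A ->
  pushforward p f \in @compactly_supported Y A.
Proof.
move=> hY [cp op _] pU fU /compactly_supportedP[cf kf].
have pfx x : f x != 0 -> pushforward p f (p x) = f x.
  move=> fx; rewrite (@pushforward_widen _ _ _ _ _ [set x]) ?fsbig_set1//.
    move=> z [fz pz]; apply: pU; rewrite ?inE; [exact: fU|exact: fU|exact: pz].
  by move=> _ ->.
have pf0 y : ~ (p @` fsupp f) y -> pushforward p f y = 0.
  move=> ny; apply: fsbig1 => x px; apply: contrapT => /eqP fx.
  by apply: ny; exists x.
have kp : compact (p @` fsupp f).
  by apply: continuous_compact kf; exact: continuous_subspaceT.
have Sp : fsupp (pushforward p f) = p @` fsupp f.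
  apply/seteqP; split=> y; last by move=> [x fx <-]; rewrite /fsupp /= pfx.
  by move=> fy; apply: contrapT => /pf0 f0; move: fy; rewrite /fsupp /= f0 eqxx.
apply/compactly_supportedP; rewrite Sp; split=> // y.
have [[x fx <-]|ny] := pselect ((p @` fsupp f) y); last first.
  apply: (@filterS _ _ _ (~` (p @` fsupp f))); last first.
    apply: nbhs_open => //; apply: closed_openC; exact: compact_closed.
  by move=> z nz /=; rewrite !pf0.
have xf : nbhs x (fsupp f) by apply: nbhs_open => //;
  exact: (fsupp_clopen cf).1.
apply: filterS (op _ _ (filterI xf (cf x))) => _ [z [fz fzx] <-] /=.
by rewrite !pfx.
Qed.

Lemma compactly_supportedD X (f g : X -> A) :
  f \in @compactly_supported X A -> g \in @compactly_supported X A ->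
  f + g \in @compactly_supported X A.
Proof. exact: rpredD. Qed.

Lemma pushforwardD X Y (p : X -> Y) (f g : X -> A) : etale_map p ->
  f \in @compactly_supported X A -> g \in @compactly_supported X A ->
  pushforward p (f + g) = pushforward p f + pushforward p g.
Proof.
move=> ep fc gc; have fg := compactly_supportedD fc gc.
have fin h : h \in @compactly_supported X A -> fibre_finite p h.
  by move=> /compactly_supportedP[_]; exact: etale_map_fibre_finite.
rewrite -[in RHS](addrK g f) pushforwardB ?subrK//; exact: fin.
Qed.

(** The support is covered by finitely many clopen sets on which p is
    injective, and f is cut accordingly. *)
Lemma pushforward_Cc X Y (p : X -> Y) (f : X -> A) :
  clopen_base X -> hausdorff_space Y -> etale_map p ->
  f \in @compactly_supported X A ->
    pushforward p f \in @compactly_supported Y A.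
Proof.
move=> bX hY ep fc; have /compactly_supportedP[_ kf] := fc.
pose good (C : set X) := forall g, g \in @compactly_supported X A ->
  fsupp g `<=` C -> pushforward p g \in @compactly_supported Y A.
suff [C [_ fC]] : exists C, [/\ clopen C, fsupp f `<=` C & good C].
  by move=> /(_ f fc fC).
apply: (@compact_ind X (fun K => exists C, [/\ clopen C, K `<=` C &
  good C])) kf.
- exists set0; split=> //; first exact: clopen0.
  move=> g gc; rewrite subset0 => g0.
  have -> : g = 0.
    apply/funext => x; apply: contrapT => /eqP gx.
    by have : fsupp g x by []; rewrite g0.
  rewrite (_ : pushforward p 0 = 0); first exact: rpred0.
  by apply/funext => y; exact: fsbig1.
- move=> B1 B2 [C1 [cC1 BC1 g1]] [C2 [cC2 BC2 g2]]; exists (C1 `|` C2); split.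
  + exact: clopenU.
  + by move=> x [/BC1|/BC2]; [left|right].
  + move=> g gc gC; rewrite (cutoffD C1 g).
    have h1 := cutoff_Cc cC1 gc; have h2 := cutoff_Cc (clopenC C1 cC1) gc.
    rewrite pushforwardD//; apply: compactly_supportedD.
      by apply: g1 => //; rewrite fsupp_cutoff => x [].
    by apply: g2 => //; rewrite fsupp_cutoff => x [/gC[]].
- move=> B1 B2 B12 [C [cC BC gC]]; exists C; split=> //.
  exact: subset_trans BC.
- move=> x _; have [_ _ /(_ x)[U xU pU]] := ep.
  have [C [cC Cx CU]] := bX _ _ xU; exists C; first exact: nbhs_open cC.1 Cx.
  exists C; split=> // g gc gC.
  by apply: pushforward_inj_Cc ep pU _ gc => //; exact: subset_trans CU.
Qed.

(** ** Extension *)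

(** A function that is locally constant along D with compact support in D is
    constant along D on each member of a suitable finite family of compact open
    sets covering the support; the extension takes these values. *)
Lemma Cc_extension X (D : set X) (phi : X -> A) :
  hausdorff_space X -> compact_open_base X ->
  (forall x, D x -> exists2 N, nbhs x N &
     forall y, D y -> N y -> phi y = phi x) ->
  compact (D `&` fsupp phi) ->
  exists f : Cc X A, forall x, D x -> f x = phi x.
Proof.
move=> hX bX cphi kphi.
pose good (C : set X) := forall V, clopen V -> V `<=` C ->
  exists2 f : X -> A, f \in @compactly_supported X A &
    forall x, D x -> f x = cutoff V phi x.
suff [C [cC kC gC]] : exists C, [/\ clopen C, D `&` fsupp phi `<=` C & good C].
  have [//|f fc fD] := gC C cC; exists (MkCc fc) => x Dx /=; rewrite fD//.
  have [Cx|nCx] := pselect (C x); first by rewrite cutoff_in.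
  rewrite cutoff_out//; apply: contrapT => /nesym/eqP px.
  by apply: nCx; apply: kC.
apply: (@compact_ind X (fun K => exists C, [/\ clopen C, K `<=` C &
  good C])) kphi.
- exists set0; split=> //; first exact: clopen0.
  move=> V _ V0; exists 0; first exact: rpred0.
  by move=> x _; rewrite cutoff_out// => /V0.
- move=> B1 B2 [C1 [cC1 BC1 g1]] [C2 [cC2 BC2 g2]]; exists (C1 `|` C2); split.
  + exact: clopenU.
  + by move=> x [/BC1|/BC2]; [left|right].
  + move=> V cV VC.
    have [||f fc fD] := g1 (V `&` C1); [exact: clopenI|exact: subIsetr|].
    have [||g gc gD] := g2 (V `&` ~` C1).
    * by apply: clopenI => //; exact: clopenC.
    * by move=> x [/VC[]].
    exists (f + g); first exact: compactly_supportedD.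
    move=> x Dx; rewrite !fctE fD// gD//.
    have [Vx|nVx] := pselect (V x); last first.
      by rewrite !cutoff_out ?addr0// => -[].
    have [Cx|nCx] := pselect (C1 x).
      rewrite [cutoff (V `&` ~` C1) _ _]cutoff_out ?addr0; last by case.
      by rewrite !cutoff_in.
    rewrite [cutoff (V `&` C1) _ _]cutoff_out ?add0r; last by case.
    by rewrite !cutoff_in.
- move=> B1 B2 B12 [C [cC BC gC]]; exists C; split=> //.
  exact: subset_trans BC.
- move=> x [Dx _]; have [N xN Nphi] := cphi x Dx.
  have [C [oC kC Cx CN]] := bX _ _ xN; exists C; first exact: nbhs_open oC Cx.
  have cC : clopen C by split=> //; exact: compact_closed.
  exists C; split=> // V cV VC; exists (cutoff V (fun=> phi x)).
    apply/compactly_supportedP; split.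
      by apply: cutoff_locally_constant => // y; exact: nearW.
    have [phix|phix] := eqVneq (phi x) 0.
      rewrite (_ : fsupp _ = set0); first exact: compact0.
      by rewrite fsupp_cutoff -subset0 => y []; rewrite /fsupp /= phix eqxx.
    apply: (subclosed_compact _ kC); last first.
      by rewrite fsupp_cutoff => y [_ /VC].
    rewrite (_ : fsupp _ = V); first exact: cV.2.
    by rewrite fsupp_cutoff; apply/seteqP; split=> y => [[]|].
  move=> y Dy; have [Vy|nVy] := pselect (V y); last by rewrite !cutoff_out.
  by rewrite !cutoff_in// Nphi//; exact/CN/VC.
Qed.
End CompactlySupported.

Arguments Cc_compact {A X} f.
Arguments Cc_locally_constant {A X} f.

(** * Subspaces, finite powers and nerves *)

Lemma nbhs_set_type (X : topologicalType) (B : set X) (x : B) (W : set B) :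
  nbhs x W <-> exists2 V, nbhs (val x) V & forall y : B, V (val y) -> W y.
Proof.
split=> [|[V xV VW]].
  move=> /nbhs_open_sub[_ [[V oV <-] Vx VW]]; exists V;
    first exact: nbhs_open oV Vx.
  by move=> y Vy; apply: VW.
have : nbhs x (val @^-1` V) by exact: (@initial_continuous _ _ val).
exact: nbhs_subset.
Qed.

Lemma continuous_inj_hausdorff (X Y : topologicalType) (p : X -> Y) :
  continuous p -> injective p -> hausdorff_space Y -> hausdorff_space X.
Proof.
move=> cp pI hY x y clxy; apply: pI; apply: hY => U V xU yV.
have [z [Uz Vz]] := clxy _ _ (cp _ _ xU) (cp _ _ yV).
by exists (p z).
Qed.

Lemma nbhs_ptws (n : nat) (K : topologicalType) (g : {ptws 'I_n -> K}) W :
  nbhs g W <-> exists2 U : 'I_n -> set K, forall i, nbhs (g i) (U i) &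
    forall h : {ptws 'I_n -> K}, (forall i, U i (h i)) -> W h.
Proof.
pose F : set_system {ptws 'I_n -> K} :=
  [set W | exists2 U : 'I_n -> set K, forall i, nbhs (g i) (U i) &
    forall h : {ptws 'I_n -> K}, (forall i, U i (h i)) -> W h].
have FF : Filter F.
  split.
  - by exists (fun=> setT) => // i; exact: nbhs_setT.
  - move=> A B [U gU UA] [V gV VB]; exists (fun i => U i `&` V i).
      by move=> i; exact: nbhs_setI.
    by move=> h UV; split; [apply: UA|apply: VB] => i; have [] := UV i.
  - by move=> A B AB [U gU UA]; exists U => // h /UA /AB.
split=> [|[U gU UW]]; last first.
  have : nbhs g [set h : {ptws 'I_n -> K} | forall i, U i (h i)].
    apply: nbhs_forall => i.
    exact: (@proj_continuous _ (fun=> K) i g (U i) (gU i)).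
  exact: nbhs_subset.
suff : F --> g by move=> /(_ W).
apply/cvg_sup => i V; move=> /nbhs_open_sub[_ [[C oC <-] Cg CV]].
exists (fun j => [set k | j = i -> C k]).
  move=> j; have [->|ji] := eqVneq j i.
    by apply: nbhs_subset (nbhs_open oC Cg) => k Ck _.
  by apply: nearW => k ? ; move: ji; rewrite (_ : j = i) ?eqxx.
by move=> h Uh; apply: CV; exact: Uh.
Qed.

Section NerveTopology.
Variable K : groupoidSpaceType.

Definition entry n (x : nerve K n.+1) (i : 'I_n.+1) : K := val x i.
Definition mk_nerve n (g : 'I_n.+1 -> K) (cg : composable g) : nerve K n.+1 :=
  SigSub (mem_set cg).
Definition vertex (x : nerve K 0) : K := val x.

Lemma entry_composable n (x : nerve K n.+1) : composable (entry x).
Proof. exact: set_valP x. Qed.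

Lemma vertex_unit (x : nerve K 0) : gunits (vertex x).
Proof. exact: set_valP x. Qed.

Lemma entry_inj n (x y : nerve K n.+1) : entry x =1 entry y -> x = y.
Proof. by move=> xy; apply: val_inj; apply/funext. Qed.

Lemma vertex_inj : injective vertex.
Proof. exact: val_inj. Qed.

Lemma nbhs_entries n (x : nerve K n.+1) W :
  nbhs x W <-> exists2 U : 'I_n.+1 -> set K, forall i, nbhs (entry x i) (U i) &
    forall y : nerve K n.+1, (forall i, U i (entry y i)) -> W y.
Proof.
split=> [/nbhs_set_type[V /nbhs_ptws[U xU UV] VW]|[U xU UW]].
  by exists U => // y Uy; apply: VW; exact: UV.
apply/nbhs_set_type; exists [set h | forall i, U i (h i)]; last exact: UW.
by apply/nbhs_ptws; exists U.
Qed.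

Lemma entry_continuous n (i : 'I_n.+1) : continuous (fun x => @entry n x i).
Proof.
move=> x W xW; apply/nbhs_entries; exists (fun j => [set k | j = i -> W k]).
  move=> j; have [->|ji] := eqVneq j i; first
    by apply: nbhs_subset xW => k Wk _.
  by apply: nearW => k ji'; rewrite ji' eqxx in ji.
by move=> y /(_ i); exact.
Qed.

Lemma nbhs_entry n (x : nerve K n.+1) i W : nbhs (entry x i) W ->
  nbhs x [set y | W (entry y i)].
Proof. exact: (nbhs_preimage (@entry_continuous n i)). Qed.

Lemma vertex_continuous : continuous vertex.
Proof. by move=> x W xW; apply/nbhs_set_type; exists W. Qed.

Lemma nerve_continuous n (X : topologicalType) (f : X -> nerve K n.+1) :
  (forall i, continuous (fun x => entry (f x) i)) -> continuous f.
Proof.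
move=> cf x W /nbhs_entries[U xU UW].
have : nbhs x [set y | forall i, U i (entry (f y) i)].
  apply: nbhs_forall.
  by move=> i; exact: cf (xU i).
by apply: nbhs_subset => y Uy; exact: UW.
Qed.

Lemma nerve0_continuous (X : topologicalType) (f : X -> nerve K 0) :
  continuous (fun x => vertex (f x)) -> continuous f.
Proof.
move=> cf x W /nbhs_set_type[V xV VW].
have : nbhs x [set y | V (vertex (f y))] by exact: (cf x V xV).
by apply: nbhs_subset => y Vy; exact: VW.
Qed.

Lemma nerve_hausdorff n : hausdorff_space K -> hausdorff_space (nerve K n).
Proof.
move=> hK; case: n => [|n].
  exact: (continuous_inj_hausdorff vertex_continuous vertex_inj).
move=> x y clxy; apply: entry_inj => i; apply: hK => U V xU yV.
have [z [Uz Vz]] := clxy _ _ (entry_continuous xU) (entry_continuous yV).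
by exists (entry z i).
Qed.

Lemma nerve_clopen_base n : clopen_base K -> clopen_base (nerve K n).
Proof.
move=> bK; case: n => [|n] x W.
  move=> /nbhs_set_type[V xV VW]; have [U [cU Ux UV]] := bK _ _ xV.
  exists (vertex @^-1` U); split=> //.
    by apply: preimage_clopen => //; exact: vertex_continuous.
  by move=> y /UV/VW.
move=> /nbhs_entries[V xV VW].
have /choice[U HU] : forall i, exists C : set K,
    [/\ clopen C, C (entry x i) & C `<=` V i] by move=> i; exact: bK.
exists (\bigcap_(i in [set: 'I_n.+1]) ((fun x => entry x i) @^-1` U i)).
split; last first.
- by move=> y Uy; apply: VW => i; have [_ _] := HU i; apply; exact: Uy.
- by move=> i _; have [] := HU i.
have cl i : clopen ((fun x : nerve K n.+1 => entry x i) @^-1` U i).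
  apply: preimage_clopen; first by have [] := HU i.
  exact: entry_continuous.
split; last by apply: closed_bigI => i _; exact: (cl i).2.
apply: open_nbhs_all => y Uy.
have : nbhs y [set z | forall i, U i (entry z i)].
  apply: nbhs_forall.
  by move=> i; apply: (nbhs_open (cl i).1); exact: Uy.
by apply: nbhs_subset => z Uz i _; exact: Uz.
Qed.

End NerveTopology.

(** * Faces of the nerve of an ample groupoid *)

(** The properties of étale groupoids that make the chain complex work,
    together with a base of clopen sets. They are stated by neighbourhoods of
    arrows, with r seen as a map from K to K that is open onto the units: in
    this form they can be verified for H, whose topology is not a relative one.
    *)
Record ample_groupoid (K : groupoidSpaceType) : Prop := {
  ample_hausdorff : hausdorff_space K;
  ample_base : clopen_base K;
  ample_inv : continuous (ginv : K -> K);
  ample_mul : forall (g h : K) W, gcomp g h -> nbhs (gmul g h) W ->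
    exists U V, [/\ nbhs g U, nbhs h V &
      forall g' h', U g' -> V h' -> gcomp g' h' -> W (gmul g' h')];
  ample_rng_inj : forall g : K, exists2 U, nbhs g U & set_inj U grng;
  ample_rng_open : forall (g : K) U, nbhs g U ->
    exists2 V, nbhs (grng g) V & forall u, V u -> gunits u -> (grng @` U) u
}.

Section Etale.
Implicit Types X Y Z : topologicalType.

Lemma etale_map_id X : etale_map (@id X).
Proof.
split=> [x //|x U xU|x]; first by rewrite image_id.
by exists setT; [exact: nbhs_setT|move=> a b].
Qed.

Lemma etale_map_comp X Y Z (p : Y -> Z) (q : X -> Y) :
  etale_map p -> etale_map q -> etale_map (p \o q).
Proof.
move=> [cp op ip] [cq oq iq]; split=> [x|x U xU|x].
- by apply: continuous_comp; [exact: cq|exact: cp].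
- by rewrite -image_comp; apply: op; exact: oq.
- have [U xU qU] := iq x; have [V qV pV] := ip (q x).
  exists (U `&` q @^-1` V); first by apply: nbhs_setI => //; exact: cq.
  move=> a b /set_mem[Ua Va] /set_mem[Ub Vb] /= pq.
  by apply: qU; rewrite ?inE//; apply: pV; rewrite ?inE.
Qed.

(** This is how faces are treated: with p a map to a vertex that the face q
    does not affect, only the continuity of q has to be checked by hand. *)
Lemma etale_map_factor X Y Z (p : Y -> Z) (q : X -> Y) :
  etale_map p -> etale_map (p \o q) -> continuous q -> etale_map q.
Proof.
move=> [cp op ip] [_ opq ipq] cq; split=> // [x U xU|x].
  have [N qN pN] := ip (q x).
  have xU' : nbhs x (U `&` q @^-1` N) by apply: nbhs_setI => //; exact: cq.
  have := cp _ _ (opq _ _ xU'); move=> /(nbhs_setI qN).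
  apply: nbhs_subset => y [Ny [x' [Ux' Nx'] /= pqx']].
  by exists x' => //; apply: pN; rewrite ?inE.
have [U xU pqU] := ipq x; exists U => // a b Ua Ub qab.
by apply: pqU => //=; rewrite qab.
Qed.

Lemma etale_map_involution X (q : X -> X) :
  continuous q -> involutive q -> etale_map q.
Proof.
move=> cq qK; split=> // [x U xU|x].
  have : nbhs (q x) (q @^-1` U) by apply: cq; rewrite qK.
  by apply: nbhs_subset => y Uy; exists (q y).
by exists setT; [exact: nbhs_setT|move=> a b _ _; exact: (can_inj qK)].
Qed.

End Etale.

Section AmpleTheory.
Variable K : groupoidSpaceType.
Hypothesis aK : ample_groupoid K.

Lemma gsrc_continuous : continuous (gsrc : K -> K).
Proof.
apply: preimage_continuous => g W gW; have [U [V [iU gV UVW]]] :=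
  ample_mul aK (gcompVg g) gW.
have := nbhs_setI (nbhs_preimage (ample_inv aK) iU) gV;
  apply: nbhs_subset => h [/= Uh Vh].
by apply: UVW => //; exact: gcompVg.
Qed.

Lemma grng_continuous : continuous (grng : K -> K).
Proof.
move=> g; rewrite (_ : grng = gsrc \o ginv); last first.
  by apply/funext => h /=; rewrite gsrcV.
by apply: continuous_comp; [exact: ample_inv aK _|exact: gsrc_continuous].
Qed.

Lemma ample_src_inj (g : K) : exists2 U, nbhs g U & set_inj U gsrc.
Proof.
have [U gU rU] := ample_rng_inj aK (ginv g).
exists (ginv @^-1` U); first exact: ample_inv aK _ _ gU.
move=> a b /set_mem Ua /set_mem Ub ab; apply: (can_inj (@ginvK K)).
by apply: rU; rewrite ?inE// !grngV.
Qed.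

Lemma ample_src_open (g : K) U : nbhs g U ->
  exists2 V, nbhs (gsrc g) V & forall u, V u -> gunits u -> (gsrc @` U) u.
Proof.
move=> gU; have iU : nbhs (ginv g) (ginv @^-1` U).
  by apply: (ample_inv aK); rewrite ginvK.
have [V gV rV] := ample_rng_open aK iU; rewrite grngV in gV.
exists V => // u Vu uu; have [h Uh <-] := rV u Vu uu.
by exists (ginv h) => //; rewrite gsrcV.
Qed.

Lemma vertex_face_src (x : nerve K 1) :
  vertex (face ord0 x) = gsrc (entry x ord0).
Proof. by []. Qed.

Lemma vertex_face_rng (i : 'I_2) (x : nerve K 1) : i != ord0 ->
  vertex (face i x) = grng (entry x ord0).
Proof. by move=> /negbTE i0; rewrite /vertex /face i0. Qed.

Lemma entry_face n (i : 'I_n.+3) (x : nerve K n.+2) k :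
  entry (face i x) k = face_fun i (entry x) k.
Proof. by []. Qed.

Lemma entry_continuous_comp n (f : nerve K n.+2 -> K) i :
  f = (fun x => entry x i) -> continuous f.
Proof. by move=> ->; exact: entry_continuous. Qed.

Lemma face_continuous n (i : 'I_n.+2) : continuous (@face K n i).
Proof.
case: n i => [|n] i.
  apply: nerve0_continuous; have [->|i0] := eqVneq i ord0.
    move=> x; apply: (@continuous_comp _ _ _ (fun x => entry x ord0) gsrc).
      exact: entry_continuous.
    exact: gsrc_continuous.
  rewrite (_ : (fun x => _) = grng \o (fun x => entry x ord0)); last first.
    by apply/funext => x; rewrite vertex_face_rng.
  by move=> x; apply: continuous_comp;
    [exact: entry_continuous|exact: grng_continuous].
apply: nerve_continuous => k.
have [ki|ik] := ltnP k.+1 i.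
  apply: (@entry_continuous_comp _ _ (inord k)); apply/funext => x.
  by rewrite entry_face /face_fun ki.
have [ki|nki] := eqVneq k.+1 (i : nat); last first.
  apply: (@entry_continuous_comp _ _ (inord k.+1)); apply/funext => x.
  by rewrite entry_face /face_fun ltnNge ik /= (negbTE nki).
rewrite (_ : (fun x => _) =
    fun x => gmul (entry x (inord k)) (entry x (inord k.+1))); last first.
  by apply/funext => x; rewrite entry_face /face_fun ltnNge ik /= ki eqxx.
apply: preimage_continuous => x W xW.
have comp (y : nerve K n.+2) : gcomp (entry y (inord k)) (entry y (inord k.+1)).
  by apply: entry_composable; rewrite !inordK// ltnS; have :=
    ltn_ord k => // /ltnW.
have [U [V [xU xV UVW]]] := ample_mul aK (comp x) xW.
have := nbhs_setI (nbhs_preimage (@entry_continuous _ _ _) xU)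
  (nbhs_preimage (@entry_continuous _ _ _) xV).
by apply: nbhs_subset => y [/= Uy Vy]; apply: UVW.
Qed.

Fact first_face_section_composable n (g : K) (y : nerve K n.+1) :
  gcomp g (entry y ord0) ->
  composable (fun i : 'I_n.+2 => if (i : nat) is j.+1 then entry y (inord j)
    else g).
Proof.
move=> gy i j ij; case: i ij => -[|i] /= ilt ij; rewrite ij.
  by rewrite (_ : inord 0 = ord0)//; apply/val_inj; rewrite /= inordK.
have := ltn_ord j; rewrite ij !ltnS => jn.
by apply: entry_composable; rewrite !inordK// ltnW.
Qed.

Lemma first_face_entry n (x : nerve K n.+2) (k : 'I_n.+1) :
  entry (face ord0 x) k = entry x (inord k.+1).
Proof. by []. Qed.

Lemma gcomp_first n (x : nerve K n.+2) :
  gcomp (entry x ord0) (entry (face ord0 x) ord0).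
Proof.
by rewrite first_face_entry; apply: entry_composable; rewrite inordK.
Qed.

(** A deleted first arrow is recovered from its source, which the rest of the
    tuple knows: uniquely near a given arrow because s is locally injective,
    and for all nearby tuples because s is open. *)
Lemma first_face_etale n : etale_map (@face K n.+1 ord0).
Proof.
split; first exact: face_continuous.
  move=> x W /nbhs_entries[U xU UW].
  have [V xV sV] := ample_src_open (xU ord0).
  have e0 : nbhs (entry (face ord0 x) ord0) (grng @^-1` V).
    by apply: grng_continuous; rewrite -(gcomp_first x).
  apply/nbhs_entries; exists (fun k : 'I_n.+1 =>
    [set g | U (inord k.+1) g /\ (k = ord0 -> V (grng g))]).
    move=> k; have : nbhs (entry (face ord0 x) k) (U (inord k.+1)).
      exact: xU.
    have [->|k0] := eqVneq k ord0.
      by move=> xk; apply: nbhs_subset (nbhs_setI xk e0) => g [].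
    by apply: nbhs_subset => g Ug; split=> // kE; rewrite kE eqxx in k0.
  move=> y Uy; have [_ /(_ erefl) V0] := Uy ord0.
  have [g Ug gE] := sV _ V0 (grng_unit _).
  exists (mk_nerve (first_face_section_composable gE)).
    apply: UW => -[[|i] ilt]; rewrite /entry /=.
      by rewrite (_ : Ordinal _ = ord0)//; exact: val_inj.
    have [+ _] := Uy (inord i); congr (U _ _).
    by apply: val_inj; rewrite /= !inordK.
  apply: entry_inj => k; rewrite first_face_entry /entry /= inordK.
    by rewrite inord_val.
  exact: ltn_ord k.
move=> x; have [U xU sU] := ample_src_inj (entry x ord0).
exists [set y | U (entry y ord0)]; first exact: entry_continuous xU.
move=> a b /set_mem Ua /set_mem Ub ab; apply: entry_inj => -[[|i] ilt].
  rewrite (_ : Ordinal _ = ord0); last exact: val_inj.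
  apply: sU; rewrite ?inE//.
  by rewrite (gcomp_first a) (gcomp_first b) ab.
have := congr1 (fun z => entry z (inord i)) ab; rewrite !first_face_entry.
by rewrite (_ : inord _ = Ordinal ilt)//; apply: val_inj; rewrite /= !inordK.
Qed.

Definition last_vertex n : nerve K n -> nerve K 0 :=
  if n is m.+1 then fun x : nerve K m.+1 => source_map (entry x ord_max) else
    id.

Definition first_vertex n : nerve K n -> nerve K 0 :=
  if n is m.+1 then fun x : nerve K m.+1 => range_map (entry x ord0) else id.

Lemma src_face_etale : etale_map (@face K 0 ord0).
Proof.
split; first exact: face_continuous.
  move=> x W /nbhs_entries[U xU UW].
  have [V xV sV] := ample_src_open (xU ord0).
  apply/nbhs_set_type; exists V => // y Vy.
  have [g Ug gE] := sV _ Vy (vertex_unit y).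
  have cg : composable (fun _ : 'I_1 => g) by move=> [i i1] [j j1] /= ij;
    subst; case: i i1 j1.
  exists (mk_nerve cg); first by apply: UW => i; rewrite (ord1 i).
  exact: val_inj.
move=> x; have [U xU sU] := ample_src_inj (entry x ord0).
exists [set y | U (entry y ord0)]; first exact: entry_continuous xU.
move=> a b /set_mem Ua /set_mem Ub /(congr1 (@vertex K)) ab.
by apply: entry_inj => i; rewrite (ord1 i); apply: sU; rewrite ?inE.
Qed.

(** Deleting first arrows one after the other leads to the final vertex. *)
Lemma last_vertex_etale n : etale_map (@last_vertex n).
Proof.
elim: n => [|[|n] IHn]; first exact: etale_map_id.
  rewrite (_ : @last_vertex 1 = @face K 0 ord0); first exact: src_face_etale.
  by apply/funext => x; apply: val_inj => /=; rewrite (ord1 ord_max).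
rewrite (_ : @last_vertex n.+2 = @last_vertex n.+1 \o @face K n.+1 ord0).
  exact: etale_map_comp IHn (first_face_etale _).
apply/funext => x; apply: val_inj => /=; congr gsrc.
by rewrite first_face_entry; congr (entry x _); apply: val_inj;
  rewrite /= inordK.
Qed.

Fact rev_composable n (x : nerve K n.+1) :
  composable (fun i : 'I_n.+1 => ginv (entry x (rev_ord i))).
Proof.
move=> i j ij; rewrite /gcomp gsrcV grngV; apply/esym/entry_composable => /=.
by have := ltn_ord j; rewrite ij /= => jn; rewrite subnSK.
Qed.

(** Reversal of a tuple exchanges its initial and final vertices. *)
Definition nerve_rev n (x : nerve K n.+1) : nerve K n.+1 :=
  mk_nerve (rev_composable x).

Lemma nerve_rev_etale n : etale_map (@nerve_rev n).
Proof.
apply: etale_map_involution.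
  apply: nerve_continuous => i x.
  apply: (@continuous_comp _ _ _ (fun x => entry x (rev_ord i)) ginv).
    exact: entry_continuous.
  exact: ample_inv aK _.
by move=> x; apply: entry_inj => i; rewrite /entry /= ginvK rev_ordK.
Qed.

Lemma first_vertex_etale n : etale_map (@first_vertex n).
Proof.
case: n => [|n]; first exact: etale_map_id.
rewrite (_ : @first_vertex n.+1 = @last_vertex n.+1 \o @nerve_rev n).
  exact: etale_map_comp (last_vertex_etale _) (nerve_rev_etale _).
apply/funext => x; apply: val_inj => /=; rewrite /entry/= gsrcV.
by congr (grng (entry x _)); apply: val_inj; rewrite /= subnn.
Qed.

Lemma first_vertex_face n (i : 'I_n.+2) (x : nerve K n.+1) : i != ord0 ->
  first_vertex (face i x) = first_vertex x.
Proof.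
move=> i0; have i_gt0 : (0 < i)%N by rewrite lt0n; exact: i0.
case: n i x i0 i_gt0 => [|n] i x i0 i_gt0; apply: val_inj.
  by rewrite /= (negbTE i0).
rewrite /= entry_face /face_fun /= (_ : inord 0 = ord0); last first.
  by apply: val_inj; rewrite /= inordK.
have [//|i1|_] := ltngtP 1%N (i : nat); first by rewrite ltnNge i_gt0 in i1.
by rewrite grngM//; apply: entry_composable; rewrite inordK.
Qed.

(** Only the first face moves the initial vertex r(g_1); the others inherit the
    property from the map to that vertex. *)
Lemma face_etale n (i : 'I_n.+2) : etale_map (@face K n i).
Proof.
have [->|i0] := eqVneq i ord0.
  by case: n i => [|n] i; [exact: src_face_etale|exact: first_face_etale].
apply: etale_map_factor (first_vertex_etale n) _ (@face_continuous _ i).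
rewrite (_ : _ \o _ = @first_vertex n.+1); first exact: first_vertex_etale.
by apply/funext => x; exact: first_vertex_face.
Qed.

End AmpleTheory.

(** * The Moore complex of an ample groupoid *)

Section Cancellation.
Variable V : zmodType.

(** The terms with a < b cancel those with b <= a by (a, b) |-> (b - 1, a). *)
Lemma simplicial_cancellation n (F : nat -> nat -> V) :
  (forall a b, (a < b < n.+3)%N -> F a b = F b.-1 a) ->
  \sum_(a < n.+2) \sum_(b < n.+3) F a b *~ (-1) ^+ b *~ (-1) ^+ a = 0.
Proof.
move=> FE; rewrite pair_big /= (bigID (fun ab : 'I_n.+2 * 'I_n.+3 => (ab.1 <
  ab.2)%N)) /=.
rewrite (reindex_onto
  (fun ab : 'I_n.+2 * 'I_n.+3 => (inord ab.2, inord ab.1.+1))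
  (fun ab : 'I_n.+2 * 'I_n.+3 => (inord ab.2.-1, inord ab.1))) /=; last first.
  move=> [a b] /= ab; have b_gt0 : (0 < b)%N := leq_ltn_trans (leq0n a) ab.
  have bn : (b.-1 < n.+2)%N by rewrite -ltnS prednK.
  have an : (a < n.+3)%N by rewrite (leq_trans (ltn_ord a)).
  by congr pair; apply: val_inj; rewrite /= ?inordK// prednK.
rewrite (eq_bigl (fun ab : 'I_n.+2 * 'I_n.+3 => ~~ (ab.1 < ab.2)%N)).
  rewrite -big_split /= big1// => -[a b] /= ab; rewrite -leqNgt in ab.
  have an : (a.+1 < n.+3)%N := ltn_ord a.
  have bn : (b < n.+2)%N := leq_ltn_trans ab (ltn_ord a).
  rewrite !inordK// FE; last by rewrite ltnS ab.
  rewrite /= -!mulrzA exprS mulN1r mulNr mulrNz [_ ^+ a * _]mulrC.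
  by rewrite addNr.
move=> [a b] /=; have an : (a.+1 < n.+3)%N := ltn_ord a.
rewrite -leqNgt; apply/andP/idP => [[ba /eqP[_ bE]]|ba].
  have bE' : (inord b : 'I_n.+2) = b :> nat.
    by rewrite -[in RHS]bE [RHS]inordK// (leq_trans (ltn_ord _)).
  by move: ba; rewrite bE' inordK// ltnS.
have bn : (b < n.+2)%N := leq_ltn_trans ba (ltn_ord a).
rewrite !inordK//; split=> //; apply/eqP; congr pair; apply: val_inj.
  by rewrite /= inordK.
by rewrite /= inordK.
Qed.
End Cancellation.

Section SimplicialIdentity.
Variable K : groupoidSpaceType.

(** Faces on infinite sequences of arrows, where the simplicial identities can
    be checked without bounds on the indices. *)
Definition face_seq (i : nat) (g : nat -> K) (k : nat) : K :=
  if (k.+1 < i)%N then g k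
  else if k.+1 == i then gmul (g k) (g k.+1) else g k.+1.

Lemma entry_face_seq n (i : 'I_n.+3) (x : nerve K n.+2) (k : nat) :
  (k < n.+1)%N ->
  entry (face i x) (inord k) = face_seq i (fun m => entry x (inord m)) k.
Proof. by move=> kn; rewrite entry_face /face_fun /face_seq inordK. Qed.

Lemma face_seq_face_seq (g : nat -> K) (i j k : nat) : (i < j)%N ->
  (k.+1 = i -> gcomp (g k) (g k.+1)) ->
  (k.+2 = j -> gcomp (g k.+1) (g k.+2)) ->
  face_seq i (face_seq j g) k = face_seq j.-1 (face_seq i g) k.
Proof.
case: j => // j ij c1 c2; rewrite /face_seq /=.
repeat (case: ifPn => ?); try lia; try by [].
by symmetry; apply: gmulA; [apply: c1|apply: c2]; lia.
Qed.

Lemma entry_gcomp n (x : nerve K n.+1) (k : nat) : (k.+1 < n.+1)%N ->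
  gcomp (entry x (inord k)) (entry x (inord k.+1)).
Proof. by move=> kn; apply: entry_composable; rewrite !inordK// ltnW. Qed.

Lemma eq_face_seq i (g g' : nat -> K) k : g k = g' k -> g k.+1 = g' k.+1 ->
  face_seq i g k = face_seq i g' k.
Proof. by rewrite /face_seq => -> ->. Qed.

Lemma face_face n (x : nerve K n.+2) (i j : nat) : (i < j < n.+3)%N ->
  face (inord i : 'I_n.+2) (face (inord j : 'I_n.+3) x) =
  face (inord j.-1 : 'I_n.+2) (face (inord i : 'I_n.+3) x).
Proof.
move=> /andP[ij jn].
have iE : (inord i : 'I_n.+2) = i :> nat by rewrite inordK//; lia.
have iE' : (inord i : 'I_n.+3) = i :> nat by rewrite inordK//; lia.
have jE : (inord j : 'I_n.+3) = j :> nat by rewrite inordK.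
have jE' : (inord j.-1 : 'I_n.+2) = j.-1 :> nat by rewrite inordK//; lia.
case: n x jn iE iE' jE jE' => [|n] x jn iE iE' jE jE'.
  apply: vertex_inj.
  have c01 : gcomp (entry x (inord 0)) (entry x (inord 1))
    by exact: entry_gcomp.
  have vE (h : 'I_2) (y : nerve K 1) : vertex (face h y) =
      if h == 0%N :> nat then gsrc (entry y (inord 0)) else grng (entry y
        (inord 0)).
    have -> : inord 0 = ord0 :> 'I_1 by apply: val_inj; rewrite /= inordK.
    case: eqVneq => h0; last by rewrite vertex_face_rng.
    by rewrite (_ : h = ord0)//; exact: val_inj.
  rewrite !vE iE jE' !entry_face_seq// iE' jE /face_seq.
  have [[-> ->]|[[-> ->]|[-> ->]]] : (i = 0 /\ j = 1)%N \/ (i = 0 /\ j = 2)%N \/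
      (i = 1 /\ j = 2)%N by lia.
  - by rewrite /= gsrcM.
  - by rewrite /= c01.
  - by rewrite /= grngM.
apply: entry_inj => k; rewrite -(inord_val k); have kn := ltn_ord k.
pose g m := entry x (inord m).
have fE (h : 'I_n.+4) m : (m < n.+2)%N ->
    entry (face h x) (inord m) = face_seq h g m by exact: entry_face_seq.
rewrite !entry_face_seq//.
rewrite (@eq_face_seq _ _ (face_seq j g)); last 2 first.
- by rewrite fE ?jE// ltnW.
- by rewrite fE ?jE.
rewrite [RHS](@eq_face_seq _ _ (face_seq i g)); last 2 first.
- by rewrite fE ?iE'// ltnW.
- by rewrite fE ?iE'.
rewrite iE jE'; apply: face_seq_face_seq => // _; apply: entry_gcomp; lia.
Qed.
End SimplicialIdentity.

Section Differential.
Variable A : zmodType.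

(** Evaluation at a point is additive, which moves sums and integer multiples
    in the group of functions to their values. *)
Section Eval.
Variable X : topologicalType.

Definition Cc_eval (x : X) (f : Cc X A) : A := f x.

Fact Cc_eval_additive x : zmod_morphism (Cc_eval x).
Proof. by []. Qed.

HB.instance Definition _ x :=
  GRing.isZmodMorphism.Build (Cc X A) A (Cc_eval x) (Cc_eval_additive x).

End Eval.

Section Push.
Context {X Y : topologicalType} (p : X -> Y).
Hypotheses (bX : clopen_base X) (hY : hausdorff_space Y) (ep : etale_map p).

Definition Cc_push (f : Cc X A) : Cc Y A :=
  MkCc (pushforward_Cc bX hY ep (valP f)).

Lemma Cc_fibre_finite (f : Cc X A) : fibre_finite p f.
Proof. by apply: etale_map_fibre_finite => //; exact: Cc_compact. Qed.

Fact Cc_push_additive : zmod_morphism Cc_push.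
Proof.
by move=> f g; apply: val_inj; apply: pushforwardB; exact: Cc_fibre_finite.
Qed.

HB.instance Definition _ :=
  GRing.isZmodMorphism.Build (Cc X A) (Cc Y A) Cc_push Cc_push_additive.

End Push.

Lemma val_Cc_push_comp (X Y Z : topologicalType) (p : Y -> Z) (q : X -> Y)
    (bX : clopen_base X) (hY : hausdorff_space Y) (eq : etale_map q)
    (bY : clopen_base Y) (hZ : hausdorff_space Z) (ep : etale_map p) f :
  val (Cc_push bY hZ ep (Cc_push bX hY eq f)) = pushforward (p \o q) f.
Proof.
apply: pushforward_comp; apply: etale_map_fibre_finite; last exact: Cc_compact.
exact: etale_map_comp.
Qed.

Variable K : groupoidSpaceType.
Hypothesis aK : ample_groupoid K.

Definition face_push n (i : 'I_n.+2) : Cc (nerve K n.+1) A ->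
  Cc (nerve K n) A :=
  Cc_push (nerve_clopen_base (ample_base aK)) (nerve_hausdorff (ample_hausdorff
    aK))
    (face_etale aK i).

HB.instance Definition _ n (i : 'I_n.+2) :=
  GRing.Additive.on (face_push i).

Definition Cc_boundary n (f : Cc (nerve K n.+1) A) : Cc (nerve K n) A :=
  \sum_(i < n.+2) face_push i f *~ (-1) ^+ i.

Fact Cc_boundary_additive n : zmod_morphism (@Cc_boundary n).
Proof.
move=> f g; rewrite -sumrB; apply: eq_bigr => i _.
by rewrite raddfB mulrzBl.
Qed.

HB.instance Definition _ n :=
  GRing.isZmodMorphism.Build (Cc (nerve K n.+1) A) (Cc (nerve K n) A)
    (@Cc_boundary n) (@Cc_boundary_additive n).

Lemma Cc_boundaryE n (f : Cc (nerve K n.+1) A) y :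
  Cc_boundary f y = boundary f y.
Proof.
rewrite -[LHS]/(Cc_eval y (Cc_boundary f)) raddf_sum; apply: eq_bigr => i _.
by rewrite raddfMz.
Qed.

Lemma Cc_boundary_boundary n (f : Cc (nerve K n.+2) A) :
  Cc_boundary (Cc_boundary f) = 0.
Proof.
pose F a b := face_push (inord a : 'I_n.+2) (face_push (inord b : 'I_n.+3) f).
transitivity (\sum_(a < n.+2) \sum_(b < n.+3) F a b *~ (-1) ^+ b *~ (-1) ^+ a).
  apply: eq_bigr => a _; rewrite raddf_sum mulrz_suml; apply: eq_bigr => b _.
  by rewrite raddfMz /F !inord_val.
apply: simplicial_cancellation => a b ab; apply: val_inj.
rewrite !val_Cc_push_comp; congr pushforward; apply/funext => x /=.
exact: face_face.
Qed.

Definition ample_differential : groupoid_differential K A :=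
  GroupoidDifferential (gd_d := fun n => @Cc_boundary n) Cc_boundaryE
    Cc_boundary_boundary.

End Differential.

(** * Open embeddings *)

Definition open_embedding (X Y : topologicalType) (e : X -> Y) : Prop :=
  [/\ continuous e, injective e &
      forall (x : X) W, nbhs x W -> nbhs (e x) (e @` W)].

Lemma open_embedding_etale (X Y : topologicalType) (e : X -> Y) :
  open_embedding e -> etale_map e.
Proof.
move=> [ce ie oe]; split=> // x; exists setT; first exact: nbhs_setT.
by move=> a b _ _ /ie.
Qed.

Lemma open_embedding_clopen_base (X Y : topologicalType) (e : X -> Y) :
  open_embedding e -> clopen_base Y -> clopen_base X.
Proof.
move=> [ce ie oe] bY x W /oe/bY[U [cU Ux UW]].
exists (e @^-1` U); split=> //; first exact: preimage_clopen.
by move=> y /UW[z Wz /ie zy]; rewrite -zy.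
Qed.

(** Along an injection every fibre has at most one point. *)
Lemma pushforward_inj_val (X Y : topologicalType) (A : zmodType) (e : X -> Y)
  (f : X -> A) : injective e -> extension_by_zero e f (pushforward e f).
Proof.
move=> ie; split=> [x|y ny]; last first.
  by apply: fsbig1 => x ex; case: ny; exists x.
rewrite /pushforward (_ : _ @^-1` _ = [set x]) ?fsbig_set1//.
by apply/seteqP; split=> z /=; [exact: ie|move=> ->].
Qed.

Lemma gunitsP (K : groupoidType) (u : K) : gunits u <-> gsrc u = u.
Proof.
split=> [[g _ <-]|<-]; [exact: gsrc_src|exact: gsrc_unit].
Qed.

Lemma ghom_inj_gcomp (K L : groupoidType) (p : groupoid_hom K L) (g h : K) :
  injective p -> gcomp (p g) (p h) -> gcomp g h.
Proof. by move=> ip; rewrite /gcomp -ghom_src -ghom_rng => /ip. Qed.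

Section GroupoidEmbedding.
Variables (K L : groupoidSpaceType) (p : groupoid_hom K L).
Hypothesis ep : open_embedding p.

Let cp : continuous p. Proof. by have [] := ep. Qed.
Let ip : injective p. Proof. by have [] := ep. Qed.
Let op (x : K) W : nbhs x W -> nbhs (p x) (p @` W).
Proof. by have [_ _] := ep; apply. Qed.

Lemma ample_open_embedding : ample_groupoid L -> ample_groupoid K.
Proof.
move=> aL; split.
- exact: continuous_inj_hausdorff cp ip (ample_hausdorff aL).
- exact: open_embedding_clopen_base ep (ample_base aL).
- apply: preimage_continuous => g W /op; rewrite ghomV => gW.
  have := nbhs_preimage cp (nbhs_preimage (ample_inv aL) gW).
  by apply: nbhs_subset => h [k Wk]; rewrite -ghomV => /ip kE; rewrite /= -kE.
- move=> g h W gh /op; rewrite ghomM// => ghW.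
  have pgh : gcomp (p g) (p h) by rewrite /gcomp -ghom_src -ghom_rng gh.
  have [U [V [gU hV UVW]]] := ample_mul aL pgh ghW.
  exists (p @^-1` U), (p @^-1` V); split;
    [exact: nbhs_preimage|exact: nbhs_preimage|].
  move=> g' h' Ug' Vh' gh'.
  have pgh' : gcomp (p g') (p h') by rewrite /gcomp -ghom_src -ghom_rng gh'.
  by have [k Wk] := UVW _ _ Ug' Vh' pgh'; rewrite -ghomM// => /ip <-.
- move=> g; have [U gU rU] := ample_rng_inj aL (p g).
  exists (p @^-1` U); first exact: nbhs_preimage.
  move=> a b /set_mem Ua /set_mem Ub ab; apply/ip/rU; rewrite ?inE//.
  by rewrite -!ghom_rng ab.
- move=> g U /op gU; have [V gV rV] := ample_rng_open aL gU.
  exists (p @^-1` V); first by apply: nbhs_preimage => //; rewrite ghom_rng.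
  move=> u Vu /(ghom_unit p) uu; have [_ [h Uh <-]] := rV _ Vu uu.
  by rewrite -ghom_rng => /ip <-; exists h.
Qed.

Lemma entry_nerve_map n (x : nerve K n.+1) i :
  entry (nerve_map p n.+1 x) i = p (entry x i).
Proof. by []. Qed.

Lemma vertex_nerve_map (x : nerve K 0) :
  vertex (nerve_map p 0 x) = p (vertex x).
Proof. by []. Qed.

(** Composability lifts along an injective homomorphism, so a tuple whose
    entries lie in the image of p is the image of a composable tuple. *)
Lemma nerve_map_open_embedding n : open_embedding (nerve_map p n).
Proof.
case: n => [|n]; split.
- apply: nerve0_continuous => x; apply: (@continuous_comp _ _ _ (@vertex K) p).
    exact: vertex_continuous.
  exact: cp.
- by move=> x y /(congr1 (@vertex L)) xy; apply/vertex_inj/ip.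
- move=> x W /nbhs_set_type[V /op xV VW]; apply/nbhs_set_type.
  exists (p @` V) => // y [k Vk pk].
  have ku : gunits k.
    by apply/gunitsP/ip; rewrite ghom_src pk; apply/gunitsP; exact: vertex_unit.
  exists (SigSub (mem_set ku)); first exact: VW.
  exact: vertex_inj.
- apply: nerve_continuous => i x.
  apply: (@continuous_comp _ _ _ (fun x => entry x i) p).
    exact: entry_continuous.
  exact: cp.
- move=> x y xy; apply: entry_inj => i; apply: ip.
  by rewrite -!entry_nerve_map xy.
- move=> x W /nbhs_entries[U xU UW]; apply/nbhs_entries.
  exists (fun i => p @` U i) => [i|y Uy]; first exact: (op (xU i)).
  have /choice[k kP] : forall i, exists k, U i k /\ p k = entry y i.
    by move=> i; have [k] := Uy i; exists k.
  have ck : composable k.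
    move=> i j ij; apply: (ghom_inj_gcomp ip); rewrite (kP i).2 (kP j).2.
    exact: entry_composable.
  exists (mk_nerve ck); first by apply: UW => i; exact: (kP i).1.
  by apply: entry_inj => i; rewrite entry_nerve_map; exact: (kP i).2.
Qed.

Lemma nerve_map_face n (i : 'I_n.+2) (x : nerve K n.+1) :
  nerve_map p n (face i x) = face i (nerve_map p n.+1 x).
Proof.
case: n i x => [|n] i x.
  apply: vertex_inj; rewrite vertex_nerve_map.
  have [->|i0] := eqVneq i ord0; first by rewrite !vertex_face_src ghom_src.
  by rewrite !vertex_face_rng// ghom_rng.
apply: entry_inj => k; rewrite entry_nerve_map !entry_face /face_fun.
case: ifP => // _; case: ifP => // _; rewrite ghomM//.
by apply: entry_composable; rewrite !inordK// ltnS; have :=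
  ltn_ord k => // /ltnW.
Qed.

Variable A : zmodType.
Hypothesis aL : ample_groupoid L.
Let aK : ample_groupoid K := ample_open_embedding aL.

(** Extension by zero along an open embedding is the direct image, so that its
    compatibility with the differentials is functoriality. *)
Definition nerve_push n : Cc (nerve K n) A -> Cc (nerve L n) A :=
  Cc_push (nerve_clopen_base (ample_base aK)) (nerve_hausdorff (ample_hausdorff
    aL))
    (open_embedding_etale (nerve_map_open_embedding n)).

HB.instance Definition _ n := GRing.Additive.on (@nerve_push n).

Fact nerve_push_boundary n (f : Cc (nerve K n.+1) A) :
  nerve_push (Cc_boundary aK f) = Cc_boundary aL (nerve_push f).
Proof.
rewrite raddf_sum; apply: eq_bigr => i _; rewrite raddfMz; congr (_ *~ _).
apply: val_inj; rewrite !val_Cc_push_comp.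
by congr pushforward; apply/funext => x /=; exact: nerve_map_face.
Qed.

Definition nerve_chain_map :
    chain_map (groupoid_complex (ample_differential A aK))
      (groupoid_complex (ample_differential A aL)) :=
  @ChainMap (groupoid_complex (ample_differential A aK))
    (groupoid_complex (ample_differential A aL))
    (fun n => @nerve_push n) nerve_push_boundary.

Lemma nerve_chain_map_extension n (f : Cc (nerve K n) A) :
  extension_by_zero (nerve_map p n) f (nerve_chain_map n f).
Proof.
by apply: pushforward_inj_val; have [_ + _] := nerve_map_open_embedding n.
Qed.

End GroupoidEmbedding.

(** * Étale groupoids with totally disconnected arrow space are ample *)

Section AmpleEtale.
Variable G : groupoidSpaceType.
Hypothesis etale_G : etale_groupoid G.

Lemma etale_mul (g h : G) W : gcomp g h -> nbhs (gmul g h) W ->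
  exists U V, [/\ nbhs g U, nbhs h V &
    forall g' h', U g' -> V h' -> gcomp g' h' -> W (gmul g' h')].
Proof.
move=> gh ghW; have [_ _ _ [_ /subspace_continuousP cm] _] := etale_G.
have [[U V] /= [gU hV] UVW] := cm (g, h) gh W ghW.
by exists U, V; split=> // g' h' Ug' Vh'; apply: (UVW (g', h')).
Qed.

Lemma etale_rng_inj (g : G) : exists2 U, nbhs g U & set_inj U grng.
Proof.
have [_ _ _ _ /(_ g)[U [s [[oU Ug] _ Us _ _]]]] := etale_G.
exists U; first exact: nbhs_open.
move=> a b Ua Ub ab; rewrite -(Us a Ua) -(Us b Ub); congr s.
exact: val_inj.
Qed.

Lemma etale_rng_open (g : G) U : nbhs g U ->
  exists2 V, nbhs (grng g) V & forall u, V u -> gunits u -> (grng @` U) u.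
Proof.
move=> gU.
have [_ _ _ _ /(_ g)[O [s [[oO Og] oO' Os _ /subspace_continuousP cs]]]] :=
  etale_G.
have gO' : (@range_map G @` O) (range_map g) by exists g.
have sU : nbhs (s (range_map g)) U by rewrite Os// inE.
have /= sU' := cs _ gO' U sU.
have /nbhs_set_type[V gV VU] :
    nbhs (range_map g) [set y | (@range_map G @` O) y /\ U (s y)].
  have := nbhs_setI (nbhs_open oO' gO') sU'.
  by apply: nbhs_subset => y [Oy /(_ Oy)].
exists V => // u Vu uu.
have [[o Oo oE] Us] := VU (SigSub (mem_set uu)) Vu.
exists o; last by have := congr1 val oE.
by rewrite -oE Os ?inE// in Us.
Qed.

Lemma etale_compact_open_base : totally_disconnected [set: G] ->
  compact_open_base G.
Proof.
by have [_ lG hG _ _] := etale_G; exact: totally_disconnected_compact_open_base.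
Qed.

Lemma etale_ample : totally_disconnected [set: G] -> ample_groupoid G.
Proof.
move=> tdG; have [_ _ hG [cV _] _] := etale_G; split=> //.
- exact/compact_open_base_clopen/etale_compact_open_base.
- exact: etale_mul.
- exact: etale_rng_inj.
- exact: etale_rng_open.
Qed.

End AmpleEtale.

Lemma sg_space_open_embedding (G : groupoidSpaceType) (G' : subgroupoid G) :
  open (G' : set G) -> open_embedding (sg_space_incl G').
Proof.
move=> oG'; split.
- by move=> x W xW; apply/nbhs_set_type; exists W.
- exact: val_inj.
- move=> x W /nbhs_set_type[V xV VW].
  have := nbhs_setI xV (nbhs_open oG' (set_valP x)).
  apply: nbhs_subset => y [Vy G'y]; exists (SigSub (mem_set G'y)) => //.
  exact: VW.
Qed.

(** * The topology of H *)

Section Complement.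
Variables (G : groupoidSpaceType) (G' : subgroupoid G).
Local Notation D := (Delta G').
Local Notation Y := (rDelta G').

Lemma gmulKVl (G0 : groupoidType) (g h : G0) : grng g = grng h ->
  gcomp (ginv g) h /\ gmul g (gmul (ginv g) h) = h.
Proof.
move=> gh; have c : gcomp (ginv g) h by rewrite /gcomp gsrcV.
by split=> //; rewrite -{1}(ginvK g); exact: gmulKV.
Qed.

Lemma Delta_mulr g d : sg_set G' g -> D d -> gcomp g d -> D (gmul g d).
Proof.
move=> G'g Dd gd G'gd; apply: Dd; rewrite -(gmulKV _ _ gd).
by apply: sg_mul => //; [rewrite /gcomp gsrcV grngM|exact: sg_inv].
Qed.

Lemma Delta_mull d g : D d -> sg_set G' g -> gcomp d g -> D (gmul d g).
Proof.
move=> Dd G'g dg G'dg; apply: Dd; rewrite -(gmulVK _ _ dg).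
by apply: sg_mul => //; [rewrite /gcomp grngV gsrcM|exact: sg_inv].
Qed.

Lemma rDelta_rng d : D d -> Y (grng d).
Proof. by exists d. Qed.

(** The range of Delta is invariant: if s(g) = r(d) with d in Delta, then
    either g or g d lies in Delta, and both have range r(g). *)
Lemma rDelta_src_rng g : Y (gsrc g) -> Y (grng g).
Proof.
move=> [d Dd rd]; have [G'g|] := pselect (sg_set G' g); last exact: rDelta_rng.
have gd : gcomp g d by [].
by exists (gmul g d); [exact: Delta_mulr|rewrite grngM].
Qed.

Lemma rDelta_rng_src g : Y (grng g) -> Y (gsrc g).
Proof. by rewrite -gsrcV => /rDelta_src_rng; rewrite grngV. Qed.

Definition mkH g (Yg : Y (grng g)) : H_space G' :=
  SigSub (mem_set (And3 I Yg (rDelta_rng_src Yg) : sg_set (H_sub G') g)).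

Local Notation iota := (H_incl G').

Lemma H_incl_mkH g (Yg : Y (grng g)) : iota (mkH Yg) = g.
Proof. by []. Qed.

Lemma H_incl_inj : injective iota.
Proof. exact: val_inj. Qed.

Lemma rDelta_H (h : H_space G') : Y (grng (iota h)).
Proof. by have [] := set_valP h. Qed.

(** Open sets of the range of Delta for the quotient topology along r; they are
    kept as sets of arrows, of which only the units in that range matter. *)
Definition range_open (S : set G) :=
  exists2 O : set G, open O & forall d, D d -> (O d <-> S (grng d)).

(** The quotient topology on H' and the relative topology on Delta, unfolded:
    openness in H is tested at arrows of Delta and at products of two of them.
    *)
Lemma H_open_preimage (P : set G) :
  (forall d, D d -> P d ->
     exists2 N, nbhs d N & forall d', D d' -> N d' -> P d') ->
  (forall a b, Delta_pairs G' (a, b) -> P (gmul a b) ->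
     exists U V, [/\ nbhs a U, nbhs b V & forall a' b',
       U a' -> V b' -> Delta_pairs G' (a', b') -> P (gmul a' b')]) ->
  open [set h : H_space G' | P (iota h)].
Proof.
move=> PD PM; suff : H_open [set h : H_space G' | P (iota h)] by [].
split.
  suff : open (@Delta_mul G G' @^-1` (@H'_to_H G G' @^-1` [set h | P (iota
    h)])) by [].
  apply: open_nbhs_all => p Pp; have [a [b pE]] : exists a b, val p = (a, b).
    by case: (val p) => a b; exists a, b.
  have pM := set_valP p; rewrite /= pE in pM.
  have [U [V [aU bV UVP]]] : exists U V, [/\ nbhs a U, nbhs b V & forall a' b',
       U a' -> V b' -> Delta_pairs G' (a', b') -> P (gmul a' b')].
    by apply: PM => //; move: Pp; rewrite /= pE.
  apply/nbhs_set_type; exists (U `*` V).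
    by rewrite pE; exists (U, V).
  move=> q [/= Uq Vq] /=; apply: UVP => //.
  by rewrite -surjective_pairing; exact: set_valP.
apply: open_nbhs_all => d Pd; have [N dN NP] := PD _ (set_valP d) Pd.
apply/nbhs_set_type; exists N => // d' Nd'; exact: (NP _ (set_valP d') Nd').
Qed.

Hypothesis etale_G : etale_groupoid G.

Let cinv : continuous (ginv : G -> G).
Proof. by have [_ _ _ []] := etale_G. Qed.

Lemma range_open_src S d : range_open S -> D d -> S (gsrc d) ->
  exists2 N, nbhs d N & forall d', D d' -> N d' -> S (gsrc d').
Proof.
move=> [O oO OS] Dd Sd; exists (ginv @^-1` O).
  apply: nbhs_preimage => //; apply: nbhs_open => //.
  by apply/OS; [exact: Delta_inv|rewrite grngV].
by move=> d' Dd' /OS; rewrite grngV; apply; exact: Delta_inv.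
Qed.

Lemma range_open_rng S d : range_open S -> D d -> S (grng d) ->
  exists2 N, nbhs d N & forall d', D d' -> N d' -> S (grng d').
Proof.
move=> [O oO OS] Dd Sd; exists O; first by apply: nbhs_open => //; exact/OS.
by move=> d' Dd' /OS; apply.
Qed.

Lemma H_incl_continuous : continuous iota.
Proof.
apply/continuousP => U oU; apply: (@H_open_preimage U) => [d Dd Ud|a b].
  by exists U => //; exact: nbhs_open.
move=> [/= ab Da Db _] Uab.
have [V [W [aV bW VWU]]] := etale_mul etale_G ab (nbhs_open oU Uab).
exists V, W; split=> // a' b' Va' Wb' [/= ab' _ _ _].
exact: VWU.
Qed.

Lemma H_open_rng S : range_open S -> open [set h | S (grng (iota h))].
Proof.
move=> oS; apply: (@H_open_preimage [set g | S (grng g)]) => [d|a b].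
  exact: range_open_rng.
move=> [/= ab Da Db _]; rewrite /= grngM// => Sa.
have [N aN NS] := range_open_rng oS Da Sa.
exists N, setT; split=> //; first exact: nbhs_setT.
by move=> a' b' Na' _ [/= ab' Da' _ _]; rewrite /= grngM//; exact: NS.
Qed.

Lemma H_open_src S : range_open S -> open [set h | S (gsrc (iota h))].
Proof.
move=> oS; apply: (@H_open_preimage [set g | S (gsrc g)]) => [d|a b].
  exact: range_open_src.
move=> [/= ab Da Db _]; rewrite /= gsrcM// => Sb.
have [N bN NS] := range_open_src oS Db Sb.
exists setT, N; split=> //; first exact: nbhs_setT.
by move=> a' b' _ Nb' [/= ab' _ Db' _]; rewrite /= gsrcM//; exact: NS.
Qed.

Hypothesis regular_G' : regular_inclusion G'.

(** In this form regularity is used: r is open from Delta to its range with the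
    quotient topology. *)
Lemma regular_range_open (U : set G) : open U -> range_open (grng @` (U `&` D)).
Proof.
move=> oU; have oU' : open (val @^-1` U : set D) by exists U.
have : open (@rng_Delta G G' @^-1` (@rng_Delta G G' @` (val @^-1` U))).
  exact: regular_G' oU'.
move=> [O oO OE]; exists O => // d Dd.
pose d' : D := SigSub (mem_set Dd).
transitivity ((val @^-1` O : set D) d') => //.
rewrite [X in X _ <-> _]OE; split=> [[e Ue /(congr1 val) /= er]|[e [Ue De] er]].
  by exists (val e) => //; split=> //; exact: set_valP.
by exists (SigSub (mem_set De)) => //; exact: val_inj.
Qed.

Hypothesis open_G' : open (G' : set G).

(** The topology of H is the coarsest one for which the inclusion into G and
    the map r to the range of Delta, with its quotient topology, are
    continuous. Regularity makes it that coarse: in a bisection around an arrow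
    of Delta the arrows of Delta are recognized by their ranges, and an arrow g
    of G' is the product of h and h^-1 g, where h in Delta with r(h) = r(g) can
    be found near a fixed arrow of Delta as soon as r(g) is near its range. *)
Lemma nbhs_H (g : H_space G') W : nbhs g W <->
  exists U S, [/\ nbhs (iota g) U, range_open S, S (grng (iota g)) &
    forall h : H_space G', U (iota h) -> S (grng (iota h)) -> W h].
Proof.
split; last first.
  move=> [U [S [gU oS Sg USW]]].
  have := nbhs_setI (nbhs_preimage H_incl_continuous gU)
    (nbhs_open (H_open_rng oS) Sg).
  by apply: nbhs_subset => h [Uh Sh]; exact: USW.
move=> /nbhs_open_sub[W' [[oW1 oW2] W'g W'W]].
have [G'g|Dg] := pselect (sg_set G' (iota g)); last first.
  have {}Dg : D (iota g) := Dg; have [O oO OE] := oW2.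
  have Og : O (iota g).
    have : (val @^-1` O : set D) (SigSub (mem_set Dg)).
      by rewrite OE /= (_ : Delta_to_H _ = g)//; exact: val_inj.
    by [].
  have [B gB rB] := etale_rng_inj etale_G (iota g).
  have [B' [oB' B'g B'B]] := nbhs_open_sub gB.
  exists B', (grng @` ((B' `&` O) `&` D)); split.
  - exact: nbhs_open.
  - by apply: regular_range_open; exact: openI.
  - by exists (iota g).
  - move=> h B'h [d [[B'd Od] Dd] rd]; apply: W'W.
    have dh : d = iota h by apply: rB; rewrite ?inE//; exact: B'B.
    have : (val @^-1` O : set D) (SigSub (mem_set Dd)) by [].
    by rewrite OE /= (_ : Delta_to_H _ = h)//; exact: val_inj.
(* The case of an arrow g of G', as a product of h and h^-1 g. *)
have [h Dh rh] := rDelta_H g.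
have [c hg] := gmulKVl rh.
have Dk : D (gmul (ginv h) (iota g)) by apply: Delta_mull => //;
  exact: Delta_inv.
have hk : gcomp h (gmul (ginv h) (iota g)) by rewrite /gcomp grngM// grngV.
have pP : Delta_pairs G' (h, gmul (ginv h) (iota g)) by split=> //=; rewrite hg.
pose p : Delta_pairs G' := SigSub (mem_set pP).
have oW1' : open (@Delta_mul G G' @^-1` (@H'_to_H G G' @^-1` W')) by exact: oW1.
have Wp : (@Delta_mul G G' @^-1` (@H'_to_H G G' @^-1` W')) p.
  rewrite /preimage /= (_ : H'_to_H _ = g)//.
  by apply: val_inj => /=; rewrite hg.
have /nbhs_set_type[N pN NW] := nbhs_open oW1' Wp.
have [[N1 N2] /= [hN1 kN2] N12] := pN.
have [U1 [U2 [hU1 gU2 U12]]] := etale_mul etale_G c kN2.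
have [O1 [oO1 O1h O1N]] :=
  nbhs_open_sub (nbhs_setI hN1 (nbhs_preimage cinv hU1)).
exists (U2 `&` G'), (grng @` (O1 `&` D)); split.
- by apply: nbhs_setI => //; exact: nbhs_open.
- exact: regular_range_open.
- by exists h.
- move=> x [U2x G'x] [a [O1a Da] ra]; apply: W'W.
  have [N1a U1a] := O1N _ O1a; have [cx ax] := gmulKVl ra.
  have Dax : D (gmul (ginv a) (iota x)) by apply: Delta_mull => //;
    exact: Delta_inv.
  have ak : gcomp a (gmul (ginv a) (iota x)) by rewrite /gcomp grngM// grngV.
  have qP : Delta_pairs G' (a, gmul (ginv a) (iota x)) by split=> //=;
    rewrite ax.
  pose q : Delta_pairs G' := SigSub (mem_set qP).
  have Nq : N (val q) by apply: N12; split=> //; exact: U12.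
  have := NW q Nq.
  rewrite /preimage /= (_ : H'_to_H _ = x)//.
  by apply: val_inj => /=; rewrite ax.
Qed.
End Complement.

Lemma nerve_map_range_entries (K L : groupoidSpaceType) (p : groupoid_hom K L)
    n (x : nerve L n.+1) : injective p ->
  range (nerve_map p n.+1) x <-> forall i, range p (entry x i).
Proof.
move=> ip; split=> [[y _ <-] i|px]; first by exists (entry y i).
have /choice[k kP] : forall i, exists k, p k = entry x i.
  by move=> i; have [k _] := px i; exists k.
have ck : composable k.
  by move=> i j ij; apply: (ghom_inj_gcomp ip); rewrite !kP;
    exact: entry_composable.
by exists (mk_nerve ck) => //; apply: entry_inj => i; rewrite entry_nerve_map;
  exact: kP.
Qed.

Lemma nerve_map_range_vertex (K L : groupoidSpaceType) (p : groupoid_hom K L)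
    (x : nerve L 0) : injective p ->
  range (nerve_map p 0) x <-> range p (vertex x).
Proof.
move=> ip; split=> [[y _ <-]|[k _ pk]]; first by exists (vertex y).
have ku : gunits k.
  by apply/gunitsP/ip; rewrite ghom_src pk; apply/gunitsP; exact: vertex_unit.
by exists (SigSub (mem_set ku)) => //; exact: vertex_inj.
Qed.

(** Any two positions of a tuple are joined by a chain of consecutive ones. *)
Lemma ord_consecutive_ind n (P : 'I_n -> Prop) :
  (forall i j : 'I_n, j = i.+1 :> nat -> P i <-> P j) ->
  forall i j, P i -> P j.
Proof.
move=> PS.
suff PE k (i j : 'I_n) : (j = i + k :> nat)%N -> P i <-> P j.
  move=> i j; have [ij|/ltnW ji] := leqP i j.
    by rewrite (PE (j - i)%N i j)// subnKC.
  by rewrite -(PE (i - j)%N j i)// subnKC.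
elim: k j => [|k IHk] j ijk.
  by rewrite (_ : i = j)//; apply: val_inj; rewrite /= ijk addn0.
have kn : (i + k < n)%N by rewrite -addnS -ijk in IHk *; have := ltn_ord j; lia.
rewrite (IHk (Ordinal kn))//; apply: PS => /=; lia.
Qed.

(** * The groupoids H and H' *)

Section AmpleH.
Variables (G : groupoidSpaceType) (G' : subgroupoid G).
Hypotheses (etale_G : etale_groupoid G) (td_G : totally_disconnected [set: G]).
Hypotheses (open_G' : open (G' : set G)).
Hypothesis units_G' : gsrc @` (G' : set G) = (gunits : set G).
Hypothesis regular_G' : regular_inclusion G'.
Local Notation D := (Delta G').
Local Notation Y := (rDelta G').
Local Notation iota := (H_incl G').

Let ample_G : ample_groupoid G := etale_ample etale_G td_G.
Let nbhsH := nbhs_H etale_G regular_G' open_G'.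
Let cont_iota : continuous iota := H_incl_continuous etale_G.

(** For C compact open in G the set r(C `&` Delta) is open in the quotient
    topology by regularity, and it is compact, hence closed already in G. *)
Lemma range_open_clopen_base S d : range_open G' S -> D d -> S (grng d) ->
  exists T, [/\ range_open G' T, range_open G' (~` T), T (grng d) &
    forall u, T u -> S u].
Proof.
move=> [O oO OS] Dd Sd.
have [|C [oC kC Cd CO]] := etale_compact_open_base etale_G td_G (x :=
  d) (W := O).
  by apply: nbhs_open => //; exact/OS.
have kT : compact (grng @` (C `&` D)).
  apply: continuous_compact; last first.
    by apply: compact_closedI => //; exact: open_closedC.
  by apply: continuous_subspaceT; exact: grng_continuous.
exists (grng @` (C `&` D)); split.
- exact: regular_range_open.
- exists (grng @^-1` (~` (grng @` (C `&` D)))) => //.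
  apply: open_comp; first by move=> x _; exact: grng_continuous.
  by apply: closed_openC; apply: compact_closed => //; exact: ample_hausdorff.
- by exists d.
- by move=> u [c [/CO Oc Dc] <-]; exact/OS.
Qed.

(** Every property is inherited from G and from the range of Delta, since the
    topology of H is initial for these two. *)
Lemma ample_H : ample_groupoid (H_space G').
Proof.
split.
- exact: continuous_inj_hausdorff cont_iota (@H_incl_inj _ _) (ample_hausdorff
  ample_G).
- move=> g W /nbhsH[U [S [gU oS Sg USW]]].
  have [C [cC Cg CU]] := ample_base ample_G gU.
  have [d Dd dg] := rDelta_H g; rewrite -dg in Sg.
  have [T [oT oT' Td TS]] := range_open_clopen_base oS Dd Sg.
  exists ((iota @^-1` C) `&` [set h | T (grng (iota h))]); split.
  + apply: clopenI; first exact: preimage_clopen.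
    split; first exact: H_open_rng.
    rewrite -[X in closed X]setCK; apply: open_closedC.
    exact: (H_open_rng oT').
  + by split=> //=; rewrite -dg.
  + by move=> h [Ch Th]; apply: USW; [exact: CU|exact: TS].
- apply: preimage_continuous => g W /nbhsH[U [S [gU oS Sg USW]]].
  rewrite ghomV in gU; rewrite ghomV grngV in Sg.
  have := nbhs_setI
    (nbhs_preimage cont_iota (nbhs_preimage (ample_inv ample_G) gU))
    (nbhs_open (H_open_src etale_G oS) Sg).
  apply: nbhs_subset => h [Uh Sh]; apply: USW; rewrite ghomV//.
  by rewrite grngV.
- move=> g h W gh /nbhsH[U [S [ghU oS Sgh USW]]].
  have pgh : gcomp (iota g) (iota h) by rewrite /gcomp -ghom_src -ghom_rng gh.
  rewrite ghomM// in ghU; rewrite ghomM// grngM// in Sgh.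
  have [V1 [V2 [gV1 hV2 V12]]] := ample_mul ample_G pgh ghU.
  exists (iota @^-1` V1 `&` [set h | S (grng (iota h))]), (iota @^-1` V2);
    split.
  + apply: nbhs_setI; first exact: nbhs_preimage.
    exact: nbhs_open (H_open_rng oS) Sgh.
  + exact: nbhs_preimage.
  + move=> g' h' [V1g Sg] V2h gh'.
    have pgh' : gcomp (iota g') (iota h')
      by rewrite /gcomp -ghom_src -ghom_rng gh'.
    by apply: USW; rewrite ghomM//; [exact: V12|rewrite grngM].
- move=> g; have [U gU rU] := ample_rng_inj ample_G (iota g).
  exists (iota @^-1` U); first exact: nbhs_preimage.
  move=> a b /set_mem Ua /set_mem Ub ab; apply: H_incl_inj; apply: rU;
    rewrite ?inE//.
  by rewrite -!ghom_rng ab.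
- move=> g W /nbhsH[U [S [gU oS Sg USW]]].
  have [V gV rV] := ample_rng_open ample_G gU.
  exists (iota @^-1` V `&` [set h | S (grng (iota h))]).
    apply: nbhs_setI; first by apply: nbhs_preimage => //; rewrite ghom_rng.
    apply: (nbhs_open (H_open_rng oS)); suff : S (grng (iota (grng g))) by [].
    by rewrite ghom_rng grng_rng.
  move=> u [Vu Su] /(ghom_unit iota) uu; have [h Uh hu] := rV _ Vu uu.
  have Yh : Y (grng h).
    by rewrite hu; have := rDelta_H u; rewrite -hu grng_rng.
  exists (mkH Yh); last by apply: H_incl_inj; rewrite ghom_rng H_incl_mkH.
  by apply: USW; rewrite H_incl_mkH// -(grng_rng h) hu.
Qed.

Lemma H'_incl_inj : injective (H'_incl G').
Proof.
move=> g h /(congr1 iota) gh; apply: val_inj; exact: gh.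
Qed.

Lemma range_H'_incl (h : H_space G') :
  range (H'_incl G') h <-> sg_set G' (iota h).
Proof.
split=> [[k _ <-]|G'h]; first by have [] := set_valP k.
have [_ Yr Ys] := set_valP h.
have hH' : sg_set (H'_sub G') (val h) by [].
by exists (SigSub (mem_set hH')) => //; exact: val_inj.
Qed.

Lemma H'_open_embedding : open_embedding (H'_incl G').
Proof.
split.
- by apply/continuousP => U [].
- exact: H'_incl_inj.
- move=> x W /nbhs_open_sub[U [oU Ux UW]].
  have oU' : open (H'_incl G' @` U).
    suff : H_open (H'_incl G' @` U) by [].
    split.
      rewrite (_ : _ @^-1` _ = U)//; apply/seteqP;
        split=> [y [z Uz /H'_incl_inj <-]//|y Uy].
      by exists y.
    rewrite (_ : _ @^-1` _ = set0); first exact: open0.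
    rewrite -subset0 => d [z Uz zd].
    have /range_H'_incl : range (H'_incl G') (Delta_to_H d) by exists z.
    exact: (set_valP d).
  apply: nbhs_subset (nbhs_open oU' _); last by exists x.
  by move=> _ [y /UW Wy <-]; exists y.
Qed.

Lemma sg_incl_inj : injective (sg_space_incl G').
Proof. exact: val_inj. Qed.

Lemma range_sg_incl g : range (sg_space_incl G') g <-> sg_set G' g.
Proof.
split=> [[k _ <-]|G'g]; first exact: set_valP k.
by exists (SigSub (mem_set G'g)).
Qed.

Lemma G'_unit u : gunits u -> sg_set G' u.
Proof.
rewrite -units_G' => -[g G'g <-].
by apply: sg_mul => //; [exact: gcompVg|exact: sg_inv].
Qed.

Lemma nerve_compl_G0 (x : nerve G 0) : ~ nerve_compl (sg_space_incl G') 0 x.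
Proof.
apply; apply/nerve_map_range_vertex; first exact: sg_incl_inj.
apply/range_sg_incl/G'_unit; exact: vertex_unit.
Qed.

Lemma nerve_compl_H0 (x : nerve (H_space G') 0) : ~ nerve_compl (H'_incl G') 0
  x.
Proof.
apply; apply/nerve_map_range_vertex; first exact: H'_incl_inj.
apply/range_H'_incl/G'_unit/(ghom_unit iota); exact: vertex_unit.
Qed.

Lemma nerve_compl_G n (x : nerve G n.+1) :
  nerve_compl (sg_space_incl G') n.+1 x <-> exists k, D (entry x k).
Proof.
have E := nerve_map_range_entries x sg_incl_inj.
split=> [nx|[k Dk] /E/(_ k)/range_sg_incl//].
apply: contrapT => nD; apply: nx; apply/E => i; apply/range_sg_incl.
by apply: contrapT => Di; apply: nD; exists i.
Qed.

Lemma nerve_compl_H n (x : nerve (H_space G') n.+1) :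
  nerve_compl (H'_incl G') n.+1 x <-> exists k, D (iota (entry x k)).
Proof.
have E := nerve_map_range_entries x H'_incl_inj.
split=> [nx|[k Dk] /E/(_ k)/range_H'_incl//].
apply: contrapT => nD; apply: nx; apply/E => i; apply/range_H'_incl.
by apply: contrapT => Di; apply: nD; exists i.
Qed.

Lemma nerve_map_iota_inj n : injective (nerve_map iota n).
Proof.
case: n => [|n] x y xy.
  by apply/vertex_inj/H_incl_inj; rewrite -!vertex_nerve_map xy.
by apply: entry_inj => i; apply: H_incl_inj; rewrite -!entry_nerve_map xy.
Qed.

Lemma nerve_map_iota_continuous n : continuous (nerve_map iota n).
Proof.
case: n => [|n].
  apply: nerve0_continuous => x;
    apply: (@continuous_comp _ _ _ (@vertex _) iota).
    exact: vertex_continuous.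
  exact: cont_iota.
apply: nerve_continuous => i x.
apply: (@continuous_comp _ _ _ (fun x => entry x i) iota).
  exact: entry_continuous.
exact: cont_iota.
Qed.

(** The ranges of all arrows of a composable tuple lie in the range of Delta as
    soon as one of them does, by invariance. *)
Lemma nerve_compl_image n : nerve_compl (sg_space_incl G') n =
  nerve_map iota n @` nerve_compl (H'_incl G') n.
Proof.
case: n => [|n]; apply/seteqP; split=> x.
- by move/nerve_compl_G0.
- by move=> [y /nerve_compl_H0].
- move=> /nerve_compl_G[k Dk].
  have Yx i : Y (grng (entry x i)).
    apply: (@ord_consecutive_ind _ (fun i => Y (grng (entry x i))) _ k).
      move=> a b ab; rewrite -(@entry_composable _ _ x _ _ ab); split.
        exact: rDelta_rng_src.
      exact: rDelta_src_rng.
    exact: rDelta_rng.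
  have cx : composable (fun i => mkH (Yx i)).
    move=> a b ab; apply: (ghom_inj_gcomp (@H_incl_inj _ G')).
    exact: entry_composable.
  have xE : nerve_map iota n.+1 (mk_nerve cx) = x by exact: entry_inj.
  exists (mk_nerve cx) => //; apply/nerve_compl_H; exists k.
  by rewrite -entry_nerve_map xE.
- move=> [y /nerve_compl_H[k Dk] <-]; apply/nerve_compl_G; exists k.
  by rewrite entry_nerve_map.
Qed.

Lemma open_Delta_H : open [set h : H_space G' | D (iota h)].
Proof.
apply: (@H_open_preimage _ _ D) => [d _ _|a b [/= _ _ _ G'ab] Dab].
  by exists setT; [exact: nbhs_setT|].
by case: Dab.
Qed.

Lemma nerve_compl_H_clopen n : clopen (nerve_compl (H'_incl G') n).
Proof.
split; last first.
  apply: open_closedC; apply: open_nbhs_all => _ [y _ <-].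
  have [_ _ op] := nerve_map_open_embedding H'_open_embedding n.
  exact: op (nbhs_setT y).
case: n => [|n]; apply: open_nbhs_all => x.
  by move/nerve_compl_H0.
move=> /nerve_compl_H[k Dk].
have := nbhs_preimage (@entry_continuous _ n k) (nbhs_open open_Delta_H Dk).
by apply: nbhs_subset => y Dy; apply/nerve_compl_H; exists k.
Qed.

Lemma nerve_compl_G_closed n : closed (nerve_compl (sg_space_incl G') n).
Proof.
apply: open_closedC; apply: open_nbhs_all => _ [y _ <-].
have [_ _ op] := nerve_map_open_embedding (sg_space_open_embedding open_G') n.
exact: op (nbhs_setT y).
Qed.

(** ** The complement of the nerve of H' has the relative topology of G *)

(** Continuity of s from H to the range of Delta, in terms of the
    neighbourhoods of nbhs_H. *)
Lemma range_open_pull (g : H_space G') S : range_open G' S ->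
  S (gsrc (iota g)) ->
  exists U T, [/\ nbhs (iota g) U, range_open G' T, T (grng (iota g)) &
    forall h : H_space G', U (iota h) -> T (grng (iota h)) ->
      S (gsrc (iota h))].
Proof.
move=> oS Sg; have /nbhsH[U [T [gU oT Tg UT]]] :=
  nbhs_open (H_open_src etale_G oS) Sg.
by exists U, T; split.
Qed.

(** For tuples near x whose k-th arrow lies in Delta, the k-th vertex stays
    close to that of x in the quotient topology; going along the arrows, in
    either direction, this holds for every other vertex. *)
Lemma range_open_propagate n (x : nerve (H_space G') n.+1) (k i : 'I_n.+1) S :
  D (iota (entry x k)) -> range_open G' S -> S (grng (iota (entry x i))) ->
  exists2 N, nbhs (nerve_map iota n.+1 x) N &
    forall y, N (nerve_map iota n.+1 y) -> D (iota (entry y k)) ->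
      S (grng (iota (entry y i))).
Proof.
move=> Dk; pose P i := forall S, range_open G' S ->
  S (grng (iota (entry x i))) ->
  exists2 N, nbhs (nerve_map iota n.+1 x) N &
    forall y, N (nerve_map iota n.+1 y) -> D (iota (entry y k)) ->
      S (grng (iota (entry y i))).
suff : P i by move=> Pi; exact: Pi.
have cE (y : nerve (H_space G') n.+1) (a b : 'I_n.+1) : b = a.+1 :> nat ->
    gsrc (iota (entry y a)) = grng (iota (entry y b)).
  by move=> ab; rewrite -ghom_src -ghom_rng (@entry_composable _ _ y _ _ ab).
apply: (@ord_consecutive_ind _ P _ k) => [a b ab|{}S oS Sk]; last first.
  have [N kN NS] := range_open_rng oS Dk Sk.
  exists [set z | N (entry z k)].
    exact: (@nbhs_entry _ _ (nerve_map iota n.+1 x)).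
  by move=> y Ny Dy; exact: NS.
split=> [Pa {}S oS Sb|Pb {}S oS Sa].
  rewrite -(cE x a b ab) in Sb.
  have [U [T [aU oT Ta UT]]] := range_open_pull oS Sb.
  have [N xN NT] := Pa T oT Ta; exists (N `&` [set z | U (entry z a)]).
    by apply: nbhs_setI => //; exact: (@nbhs_entry _ _ (nerve_map iota n.+1 x)).
  by move=> y [Ny Uy] Dy; rewrite -(cE y a b ab); apply: UT => //; exact: NT.
have Sa' : S (gsrc (iota (ginv (entry x a)))) by rewrite ghomV gsrcV.
have [U [T [aU oT Ta UT]]] := range_open_pull oS Sa'.
rewrite ghomV in aU; rewrite ghomV grngV (cE x a b ab) in Ta.
have [N xN NT] := Pb T oT Ta; exists (N `&` [set z | U (ginv (entry z a))]).
  apply: nbhs_setI => //.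
  exact: (@nbhs_entry _ _ (nerve_map iota n.+1 x) a _ (nbhs_preimage (ample_inv
    ample_G) aU)).
move=> y [Ny Uy] Dy; rewrite -gsrcV -ghomV; apply: UT; first by rewrite ghomV.
by rewrite ghomV grngV (cE y a b ab); exact: NT.
Qed.

(** A tuple y of the complement has some arrow in Delta, say the k-th. If y is
    near x then the k-th arrow of x lies in Delta too, as G' is open, and all
    vertices of y are near those of x in the range of Delta. This works for
    each of the finitely many possible k. *)
Lemma nerve_compl_H_nbhs n (x : nerve (H_space G') n) W :
  nerve_compl (H'_incl G') n x -> nbhs x W ->
  exists2 N, nbhs (nerve_map iota n x) N &
    forall y, nerve_compl (H'_incl G') n y -> N (nerve_map iota n y) -> W y.
Proof.
case: n x W => [|n] x W; first by move/nerve_compl_H0.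
move=> _ /nbhs_entries[V xV VW].
have /choice[U /choice[S US]] : forall i, exists U, exists S,
    [/\ nbhs (iota (entry x i)) U, range_open G' S, S (grng (iota (entry x i)))
      &
    forall h : H_space G', U (iota h) -> S (grng (iota h)) -> V i h].
  by move=> i; have /nbhsH[U [S]] := xV i; exists U, S.
have /choice[N NP] : forall k, exists N, nbhs (nerve_map iota n.+1 x) N /\
    forall y, N (nerve_map iota n.+1 y) -> D (iota (entry y k)) ->
      forall i, S i (grng (iota (entry y i))).
  move=> k; have [G'k|Dk] := pselect (sg_set G' (iota (entry x k))); last first.
    have /choice[N NP] : forall i, exists N, nbhs (nerve_map iota n.+1 x) N /\
        forall y, N (nerve_map iota n.+1 y) -> D (iota (entry y k)) ->
        S i (grng (iota (entry y i))).
      move=> i; have [_ oS Si _] := US i.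
      by have [N xN NS] := range_open_propagate Dk oS Si; exists N.
    exists [set z | forall i, N i z]; split.
      by apply: nbhs_forall => i; exact: (NP i).1.
    by move=> y Ny Dy i; apply: (NP i).2.
  exists [set z | sg_set G' (entry z k)]; split; last by [].
  exact: (@nbhs_entry _ _ (nerve_map iota n.+1 x) k _ (nbhs_open open_G' G'k)).
exists ([set z | forall k, N k z] `&` [set z | forall i, U i (entry z i)]).
  apply: nbhs_setI; apply: nbhs_forall => i; first exact: (NP i).1.
  have [Ui _ _ _] := US i.
  exact: (@nbhs_entry _ _ (nerve_map iota n.+1 x) i _ Ui).
move=> y /nerve_compl_H[k Dk] [Ny Uy]; apply: VW => i.
have [_ _ _ USV] := US i; apply: USV; first exact: Uy.
exact: ((NP k).2 y (Ny k) Dk i).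
Qed.

End AmpleH.

(** * Matching chains on the complement *)

Section QuotientMap.
Variables (C E : chain_complex) (f : chain_map C E).

Lemma quotient_mapP n (x y : E n) :
  quotient_map f n x = quotient_map f n y <-> range (f n) (x - y).
Proof. exact: quot_piP. Qed.

Lemma quotient_map_eq0 n (x : E n) : quotient_map f n x = 0 <-> range (f n) x.
Proof. by rewrite -(raddf0 (quotient_map f n)) quotient_mapP subr0. Qed.

Lemma quotient_map_surj n (q : quotient_complex f n) :
  exists x, quotient_map f n x = q.
Proof. by have [x ->] := quot_pi_surj q; exists x. Qed.

Lemma injective_short_exact :
  (forall n, injective (f n)) -> short_exact f (quotient_map f).
Proof.
move=> fI n; split=> //.
  by apply/seteqP; split=> y /quotient_map_eq0.
by apply/seteqP; split=> // q _; have [x <-] := quotient_map_surj q; exists x.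
Qed.

End QuotientMap.

Lemma composable_closed (K : groupoidSpaceType) n : ample_groupoid K ->
  closed (@composable K n).
Proof.
move=> aK g clg i j ij; apply: (ample_hausdorff aK) => U V gU gV.
have cproj k : continuous (fun h : {ptws 'I_n -> K} => h k).
  exact: (@proj_continuous _ (fun=> K) k).
have := nbhs_setI (nbhs_preimage (cproj i) (nbhs_preimage (gsrc_continuous aK)
  gU))
  (nbhs_preimage (cproj j) (nbhs_preimage (grng_continuous aK) gV)).
move=> /clg[h [ch [/= Uh Vh]]]; exists (gsrc (h i)); split=> //.
by rewrite (ch i j ij).
Qed.

(** Boxes of compact open sets are compact by Tychonoff, and the composable
    tuples form a closed subset. *)
Lemma nerve_compact_open_base (K : groupoidSpaceType) n : ample_groupoid K ->
  compact_open_base K -> compact_open_base (nerve K n.+1).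
Proof.
move=> aK bK x W /nbhs_entries[V xV VW].
have /choice[C CP] : forall i, exists C : set K,
    [/\ open C, compact C, C (entry x i) & C `<=` V i] by move=> i; exact: bK.
exists [set y | forall i, C i (entry y i)]; split.
- apply: open_nbhs_all => y Cy; apply: nbhs_forall => i.
  by have [oC _ _ _] := CP i; exact: nbhs_entry (nbhs_open oC (Cy i)).
- pose Q := [set g : {ptws 'I_n.+1 -> K} | forall i, C i (g i)].
  have kQ : compact Q by apply: tychonoff => i; have [] := CP i.
  have kC : compact (Q `&` @composable K n.+1).
    by apply: compact_closedI => //; exact: composable_closed.
  rewrite (_ : mkset _ =
    setT `&` (val : nerve K n.+1 -> _) @^-1` (Q `&` @composable K n.+1)).
    apply: compact_preimage_embedding kC; last first.
      by move=> g [Qg cg]; exists (mk_nerve cg).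
    move=> y U _ /nbhs_set_type[N yN NU]; exists N => // z _; exact: NU.
  apply/seteqP; split=> y; last by move=> [_ []].
  by move=> Cy; split=> //; split=> //; exact: entry_composable.
- by move=> i; have [] := CP i.
- by move=> y Cy; apply: VW => i; have [_ _ _] := CP i; apply; exact: Cy.
Qed.

Lemma open_embedding_Cc_restrict (X Y : topologicalType) (A : zmodType)
    (e : X -> Y) (f : Cc Y A) : open_embedding e ->
  (forall y, ~ range e y -> f y = 0) ->
  exists g : Cc X A, forall x, g x = f (e x).
Proof.
move=> [ce ie oe] f0.
have gc : f \o e \in @compactly_supported X A.
  apply/compactly_supportedP; split=> [x|].
    exact: nbhs_preimage ce (Cc_locally_constant f (e x)).
  rewrite (_ : fsupp _ = setT `&` e @^-1` fsupp f); last by rewrite setTI.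
  apply: (compact_preimage_embedding _ _ (Cc_compact f)) => [x W _ /oe eW|y fy].
    by exists (e @` W) => // z _ [t Wt /ie <-].
  by apply: contrapT => ny; move: fy; rewrite /fsupp /= f0 ?eqxx.
by exists (MkCc gc).
Qed.

Section Chains.
Variables (G : groupoidSpaceType) (G' : subgroupoid G) (A : zmodType).
Hypotheses (etale_G : etale_groupoid G) (td_G : totally_disconnected [set: G]).
Hypotheses (open_G' : open (G' : set G)).
Hypothesis units_G' : gsrc @` (G' : set G) = (gunits : set G).
Hypothesis regular_G' : regular_inclusion G'.
Local Notation iota := (H_incl G').
Local Notation compl_G := (nerve_compl (sg_space_incl G')).
Local Notation compl_H := (nerve_compl (H'_incl G')).

Let aG : ample_groupoid G := etale_ample etale_G td_G.
Let aH : ample_groupoid (H_space G') :=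
  ample_H etale_G td_G open_G' regular_G'.
Let eG := sg_space_open_embedding open_G'.
Let eH := H'_open_embedding G'.

Let compl_image n : compl_G n = nerve_map iota n @` compl_H n.
Proof. exact: nerve_compl_image. Qed.

(** Equality on the common complement; this relation between chains of G and
    chains of H becomes the isomorphism of the quotients. *)
Definition agree n (f : nerve G n -> A) (h : nerve (H_space G') n -> A) :=
  forall y, compl_H n y -> f (nerve_map iota n y) = h y.

(** Restriction to the complement, followed by extension by zero over the
    clopen nerve of H'; the support stays compact because the complement has
    the same topology in the nerve of G as in that of H. *)
Lemma agree_exists_H n (f : Cc (nerve G n) A) :
  exists h : Cc (nerve (H_space G') n) A, agree f h.
Proof.
(* In degree 0 the complement is empty, because G and G' have the same units. *)
case: n f => [|n] f; first by exists 0 => y /(nerve_compl_H0 units_G').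
pose h := cutoff (compl_H n.+1) (f \o nerve_map iota n.+1).
have hc : h \in @compactly_supported _ A.
  apply/compactly_supportedP; split.
    apply: cutoff_locally_constant; first exact: nerve_compl_H_clopen.
    move=> x; apply: nbhs_preimage (Cc_locally_constant f _).
    exact: nerve_map_iota_continuous.
  rewrite fsupp_cutoff setIC.
  rewrite (_ : _ `&` _ = compl_H n.+1 `&`
      nerve_map iota n.+1 @^-1` (fsupp f `&` compl_G n.+1)); last first.
    apply/seteqP; split=> x; last by move=> [cx [fx _]].
    by move=> [cx fx]; split=> //; split=> //=; rewrite compl_image; exists x.
  apply: compact_preimage_embedding.
  - exact: nerve_compl_H_nbhs.
  - by move=> z [_]; rewrite compl_image.
  - apply: compact_closedI; first exact: Cc_compact.
    exact: nerve_compl_G_closed.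
by exists (MkCc hc) => y cy; rewrite /= /h cutoff_in.
Qed.

(** Seen in the nerve of G, the restriction of h to the complement is locally
    constant because the topologies coincide there, and then it extends. *)
Lemma agree_exists_G n (h : Cc (nerve (H_space G') n) A) :
  exists f : Cc (nerve G n) A, agree f h.
Proof.
case: n h => [|n] h; first by exists 0 => y /(nerve_compl_H0 units_G').
pose phi := pushforward (nerve_map iota n.+1) h.
have phiE y : phi (nerve_map iota n.+1 y) = h y.
  by have [] := pushforward_inj_val h (@nerve_map_iota_inj _ G' n.+1).
have [||x||f fE] := @Cc_extension A _ (compl_G n.+1) phi.
- exact: nerve_hausdorff (ample_hausdorff aG).
- exact: nerve_compact_open_base (etale_compact_open_base etale_G td_G).
- rewrite compl_image => -[y cy <-].
  have [N yN NW] := nerve_compl_H_nbhs etale_G td_G open_G' units_G' regular_G'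
    cy (Cc_locally_constant h y).
  by exists N => // _ [z cz <-] Nz; rewrite !phiE; exact: NW.
- rewrite compl_image (_ : _ `&` _ = nerve_map iota n.+1 @` (fsupp h `&`
  compl_H n.+1)).
    apply: continuous_compact.
      exact/continuous_subspaceT/nerve_map_iota_continuous.
    apply: compact_closedI; first exact: Cc_compact.
    by have [] := nerve_compl_H_clopen units_G' n.+1.
  apply/seteqP; split=> x.
    by move=> [[y cy <-]]; rewrite /fsupp /= phiE => hy; exists y.
  by move=> [y [hy cy] <-]; split; [exists y|rewrite /fsupp /= phiE].
by exists f => y cy; rewrite fE ?phiE// compl_image; exists y.
Qed.

(** Faces of tuples in G' are tuples in G', so the fibre of a face map over a
    point of the complement is contained in the complement, where f and h
    agree. *)
Lemma agree_boundary n (f : nerve G n.+1 -> A) h :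
  agree f h -> agree (boundary f) (boundary h).
Proof.
move=> fh y cy; apply: eq_bigr => i _; congr (_ *~ _).
have cG : compl_G n (nerve_map iota n y) by rewrite compl_image; exists y.
rewrite /pushforward (@reindex_fsbig _ _ _ _ _ (nerve_map iota n.+1) (face i
  @^-1` [set y])).
  apply: eq_fsbigr => x /set_mem xy; apply: fh => -[z _ zx]; apply: cy.
  by exists (face i z) => //; rewrite nerve_map_face zx xy.
split=> [x xy|x1 x2 _ _|x xy].
- suff : face i (nerve_map iota n.+1 x) = nerve_map iota n y by [].
  by rewrite -nerve_map_face xy.
- exact: nerve_map_iota_inj.
have : compl_G n.+1 x.
  by move=> [z _ zx]; apply: cG; exists (face i z) => //;
    rewrite nerve_map_face zx xy.
rewrite compl_image => -[z cz zx]; exists z => //.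
by apply: (@nerve_map_iota_inj _ G'); rewrite nerve_map_face zx xy.
Qed.

Local Notation dG := (ample_differential A aG).
Local Notation dH := (ample_differential A aH).
Local Notation i := (nerve_chain_map eG A aG).
Local Notation j := (nerve_chain_map eH A aH).

Lemma nerve_chain_map_range (K L : groupoidSpaceType) (p : groupoid_hom K L)
    (ep : open_embedding p) (aL : ample_groupoid L) n (f : Cc (nerve L n) A) :
  range (nerve_chain_map ep A aL n) f <->
  forall y, nerve_compl p n y -> f y = 0.
Proof.
have ext := nerve_chain_map_extension ep (A := A) aL.
split=> [[g _ <-] y|f0]; first exact: (ext n g).2.
have [g gf] := open_embedding_Cc_restrict (nerve_map_open_embedding ep n) f0.
exists g => //; apply: Cc_inj => y; have [gE g0] := ext n g.
have [[x _ <-]|ny] := pselect (range (nerve_map p n) y); first by rewrite gE gf.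
by rewrite g0// f0.
Qed.

Lemma nerve_chain_map_short_exact (K L : groupoidSpaceType) (p : groupoid_hom K
  L)
    (ep : open_embedding p) (aL : ample_groupoid L) :
  short_exact (nerve_chain_map ep A aL) (quotient_map (nerve_chain_map ep A
    aL)).
Proof.
apply: injective_short_exact => n f g fg; apply: Cc_inj => x.
have ext := nerve_chain_map_extension ep (A := A) aL.
by rewrite -(ext n f).1 fg (ext n g).1.
Qed.

Lemma agree_quotient n (f f' : Cc (nerve G n) A) (h h' : Cc (nerve (H_space G')
  n) A) :
  agree f h -> agree f' h' ->
  quotient_map i n f = quotient_map i n f' <->
  quotient_map j n h = quotient_map j n h'.
Proof.
move=> fh fh'; split=> /quotient_mapP/nerve_chain_map_range E;
  apply/quotient_mapP/nerve_chain_map_range => y cy; rewrite CcB.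
  rewrite -fh// -fh'//; apply: E; rewrite compl_image; by exists y.
move: cy; rewrite compl_image => -[z cz <-]; rewrite fh// fh'//.
exact: E.
Qed.

(** A choice of matching chains; [agree_quotient] makes its class in the
    quotient independent of all choices. *)
Definition match_H n (f : Cc (nerve G n) A) : Cc (nerve (H_space G') n) A :=
  projT1 (cid (agree_exists_H f)).

Lemma match_HP n (f : Cc (nerve G n) A) : agree f (match_H f).
Proof. exact: projT2 (cid (agree_exists_H f)). Qed.

Definition quotient_match n (q : quotient_complex i n) : quotient_complex j n :=
  quotient_map j n (match_H (repr q)).

Lemma quotient_matchE n (f : Cc (nerve G n) A) (h : Cc (nerve (H_space G') n)
  A) :
  quotient_match (quotient_map i n f) = quotient_map j n h <-> agree f h.
Proof.
set q := quotient_map i n f.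
have qE : quotient_map i n (repr q) = quotient_map i n f by rewrite -/q;
  exact: reprK.
have E (h' : Cc (nerve (H_space G') n) A) : agree f h' ->
    quotient_match q = quotient_map j n h'.
  by move=> fh'; apply/(agree_quotient (match_HP (repr q)) fh').
split=> [qh|]; last exact: E.
have fm := match_HP f; move: (E _ fm); rewrite qh.
move=> /quotient_mapP/nerve_chain_map_range hm y cy.
by rewrite fm//; apply/esym/eqP; rewrite -subr_eq0; apply/eqP; exact: hm.
Qed.

Fact quotient_match_additive n : zmod_morphism (@quotient_match n).
Proof.
move=> p q; have [f <-] := quotient_map_surj p; have [g <-] :=
  quotient_map_surj q.
have fm := match_HP f; have gm := match_HP g.
rewrite -raddfB (quotient_matchE f (match_H f)).2// (quotient_matchE g (match_H
  g)).2//.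
rewrite -raddfB; apply/quotient_matchE => y cy.
by rewrite !CcB fm// gm.
Qed.

HB.instance Definition _ n :=
  GRing.isZmodMorphism.Build (quotient_complex i n) (quotient_complex j n)
    (@quotient_match n) (@quotient_match_additive n).

Fact quotient_match_d n (q : quotient_complex i n.+1) :
  quotient_match (ch_d (quotient_complex i) n q) =
  ch_d (quotient_complex j) n (quotient_match q).
Proof.
have [f <-] := quotient_map_surj q.
rewrite (quotient_matchE f (match_H f)).2; last exact: match_HP.
rewrite -!ch_mapd; apply/quotient_matchE => y cy.
rewrite -[LHS]/(Cc_boundary aG f _) -[RHS]/(Cc_boundary aH (match_H f) _).
rewrite !Cc_boundaryE; apply: agree_boundary cy; exact: match_HP.
Qed.

Definition quotient_match_map : chain_map (quotient_complex i)
  (quotient_complex j) :=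
  @ChainMap (quotient_complex i) (quotient_complex j)
    (fun n => @quotient_match n) quotient_match_d.

Lemma quotient_match_isomorphism : chain_isomorphism quotient_match_map.
Proof.
move=> n; rewrite -setTT_bijective; split=> // [p q _ _|q _].
  have [f <-] := quotient_map_surj p; have [g <-] := quotient_map_surj q.
  have fm := match_HP f; have gm := match_HP g.
  rewrite /= (quotient_matchE f (match_H f)).2// (quotient_matchE g (match_H
    g)).2//.
  by move=> E; apply/(agree_quotient fm gm).
have [h <-] := quotient_map_surj q; have [f fh] := agree_exists_G h.
by exists (quotient_map i n f) => //; apply/quotient_matchE.
Qed.

End Chains.

Theorem proposition3p10 (G : groupoidSpaceType) (G' : subgroupoid G)
    (A : zmodType)
    (etale_G : etale_groupoid G)
    (td_G : totally_disconnected [set: G])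
    (open_G' : open (G' : set G))
    (units_G' : gsrc @` (G' : set G) = (gunits : set G))
    (regular_G' : regular_inclusion G') :
  exists (dG : groupoid_differential G A)
         (dG' : groupoid_differential (sg_space G') A)
         (dH : groupoid_differential (H_space G') A)
         (dH' : groupoid_differential (H'_space G') A),
  exists (i : chain_map (groupoid_complex dG') (groupoid_complex dG))
         (j : chain_map (groupoid_complex dH') (groupoid_complex dH)),
  [/\ forall n (f : Cc (nerve (sg_space G') n) A),
        extension_by_zero (nerve_map (sg_space_incl G') n) f (i n f),
      forall n (f : Cc (nerve (H'_space G') n) A),
        extension_by_zero (nerve_map (H'_incl G') n) f (j n f),
      short_exact i (quotient_map i),
      short_exact j (quotient_map j) &
      (forall n, nerve_compl (sg_space_incl G') n =
        nerve_map (H_incl G') n @` nerve_compl (H'_incl G') n) /\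
      exists Phi : chain_map (quotient_complex i) (quotient_complex j),
        chain_isomorphism Phi /\
        forall n (f : Cc (nerve G n) A) (h : Cc (nerve (H_space G') n) A),
          Phi n (quotient_map i n f) = quotient_map j n h <->
          forall y, nerve_compl (H'_incl G') n y ->
            f (nerve_map (H_incl G') n y) = h y].
Proof.
pose aG := etale_ample etale_G td_G.
pose aH := ample_H etale_G td_G open_G' regular_G'.
pose eG := sg_space_open_embedding open_G'.
pose eH := H'_open_embedding G'.
exists (ample_differential A aG),
  (ample_differential A (ample_open_embedding eG aG)), (ample_differential A
    aH),
  (ample_differential A (ample_open_embedding eH aH)).
exists (nerve_chain_map eG A aG), (nerve_chain_map eH A aH); split.
- exact: nerve_chain_map_extension.
- exact: nerve_chain_map_extension.
- exact: nerve_chain_map_short_exact.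
- exact: nerve_chain_map_short_exact.
split; first exact: nerve_compl_image.
exists (quotient_match_map A etale_G td_G open_G' units_G' regular_G').
split; first exact: quotient_match_isomorphism.
exact: quotient_matchE.
Qed.
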